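(* Let $R$ be a discrete valuation ring with field of fractions $K$, uniformizer $\pi$ and residue field $k=R/\pi R$, with $\mathrm{char}(k)\neq 2$. Let $V$ be a finite-dimensional $K$-vector space, $G$ a group and $\rho:G\to\mathrm{GL}(V)$ a homomorphism such that there exists a $G$-stable lattice of $V$. Let $q$ be a nondegenerate $G$-invariant quadratic form on $V$, with class $[q]\in W(K)$. Then there exists a nondegenerate $G$-invariant quadratic form on the reduction mod $\pi$ $V_k$ of $V$ whose class in the Witt ring $W(k)$ is $\partial_1([q])+\partial_2([q])$.
   Context: A lattice of $V$ is a free $R$-submodule $L\subset V$ with $K\otimes_R L\to V$ an isomorphism. For a $G$-stable lattice $L$, the semisimplification of the $k[G]$-module $L/\pi L$ is, up to isomorphism, independent of $L$; it is denoted $V_k$. $W(F)$ denotes the Witt ring of quadratic forms over a field $F$. The Springer residues $\partial_1,\partial_2:W(K)\to W(k)$ are the additive maps (which exist and are unique; $\partial_1$ is a ring homomorphism, $\partial_2$ depends on $\pi$) characterized by: for $u\in R^\times$ with image $\bar u\in k$, $\partial_1(\langle u\rangle)=\langle\bar u\rangle$, $\partial_2(\langle u\rangle)=0$, $\partial_1(\langle u\pi\rangle)=0$, $\partial_2(\langle u\pi\rangle)=\langle \bar u\rangle$. *)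

(* Defs.v *)
From HB Require Import structures.
From mathcomp Require Export all_boot all_order all_algebra.
Set Implicit Arguments. Unset Strict Implicit. Unset Printing Implicit Defensive.
Import Order.TTheory GRing.Theory Num.Theory.
Local Open Scope ring_scope.

(* Discrete valuation rings, presented through the normalized discrete     *)
(* valuation v : K^x -> Z of the fraction field K (v 0 is irrelevant).     *)
(* R = {x | x = 0 or v x >= 0}, pi a uniformizer (v pi = 1).               *)
Definition discrete_valuation (K : fieldType) (v : K -> int) (pi : K) :=
  [/\ pi != 0, v pi = 1,
      forall x y : K, x != 0 -> y != 0 -> v (x * y) = v x + v y &
      forall x y : K, x != 0 -> y != 0 -> x + y != 0 ->
        (v x <= v (x + y)) || (v y <= v (x + y))].

Definition in_R (K : fieldType) (v : K -> int) (x : K) := (x == 0) || (0 <= v x).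
Definition in_maxid (K : fieldType) (v : K -> int) (x : K) := (x == 0) || (1 <= v x).

(* red restricted to R is a surjective ring morphism R -> k with kernel pi R,
   i.e. k is (a copy of) the residue field R / pi R. *)
Definition residue_map (K k : fieldType) (v : K -> int) (red : K -> k) :=
  [/\ red 1 = 1,
      forall x y, in_R v x -> in_R v y -> red (x + y) = red x + red y,
      forall x y, in_R v x -> in_R v y -> red (x * y) = red x * red y,
      forall c : k, exists2 x, in_R v x & red x = c &
      forall x, in_R v x -> (red x == 0) = in_maxid v x].

(* Groups and representations (row vectors, right action, as in MathComp's  *)
(* mx_representation: rho (g h) = rho g *m rho h).                          *)
Definition group_law (G : Type) (mul : G -> G -> G) (one : G) (inv : G -> G) :=
  [/\ associative mul, left_id one mul & left_inverse one inv mul].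

Definition is_rep (F : fieldType) (n : nat) (G : Type) (mul : G -> G -> G)
    (rho : G -> 'M[F]_n) :=
  (forall g, rho g \in unitmx) /\ (forall g h, rho (mul g h) = rho g *m rho h).

(* Lattices: L = R-span of the rows of an invertible matrix B (i.e. a free  *)
(* R-submodule whose R-basis is a K-basis of V = K^n).  L is G-stable iff   *)
(* the matrix of rho g in the basis B has entries in R.                     *)
Definition integral_mx (K : fieldType) (v : K -> int) m n (M : 'M[K]_(m, n)) :=
  forall i j, in_R v (M i j).

Definition stable_lattice (K : fieldType) (v : K -> int) (n : nat) (G : Type)
    (rho : G -> 'M[K]_n) (B : 'M[K]_n) :=
  B \in unitmx /\ forall g, integral_mx v (B *m rho g *m invmx B).

(* the k[G]-module L / pi L, in the basis induced by B *)
Definition red_rep (K k : fieldType) (red : K -> k) (n : nat) (G : Type)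
    (rho : G -> 'M[K]_n) (B : 'M[K]_n) : G -> 'M[k]_n :=
  fun g => map_mx red (B *m rho g *m invmx B).

(* Semisimplification.  A composition series of (k^n, tau) is given by a    *)
(* new basis (rows of Q) and a block index blk : 'I_n -> nat such that      *)
(* W_b = span{ e_i | blk i <= b } is G-stable for all b, and each graded     *)
(* piece W_b / W_(b-1) (basis: e_i with blk i = b) is irreducible.  The     *)
(* semisimplification is the associated graded module, realized on k^n by   *)
(* the block-diagonal part [graded_rep] of the matrices in the basis Q.     *)
Definition rep_in_basis (k : fieldType) (n : nat) (G : Type) (tau : G -> 'M[k]_n)
    (Q : 'M[k]_n) : G -> 'M[k]_n :=
  fun g => Q *m tau g *m invmx Q.

Definition graded_rep (k : fieldType) (n : nat) (G : Type) (tau : G -> 'M[k]_n)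
    (Q : 'M[k]_n) (blk : 'I_n -> nat) : G -> 'M[k]_n :=
  fun g => \matrix_(i, j) (if blk i == blk j then rep_in_basis tau Q g i j else 0).

Definition composition_data (k : fieldType) (n : nat) (G : Type)
    (tau : G -> 'M[k]_n) (Q : 'M[k]_n) (blk : 'I_n -> nat) :=
  [/\ Q \in unitmx,
      forall g (i j : 'I_n), (blk i < blk j)%N -> rep_in_basis tau Q g i j = 0 &
      forall (b : nat) (U : 'M[k]_n),
        (forall i (j : 'I_n), blk j != b -> U i j = 0) ->
        (forall g, (U *m graded_rep tau Q blk g <= U)%MS) ->
        U = 0 \/ \rank U = #|[pred i : 'I_n | blk i == b]| ].

(* Quadratic forms (char <> 2): a quadratic form on F^n is x |-> x S x^T    *)
(* with S symmetric (Gram matrix); nondegenerate iff S invertible;          *)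
(* G-invariant iff rho g S (rho g)^T = S for all g.                          *)
Definition nondeg_sym (F : fieldType) (n : nat) (S : 'M[F]_n) :=
  S^T = S /\ S \in unitmx.

Definition invariant_form (F : fieldType) (n : nat) (G : Type)
    (rho : G -> 'M[F]_n) (S : 'M[F]_n) :=
  forall g, rho g *m S *m (rho g)^T = S.

Definition diag_seq (F : fieldType) (s : seq F) : 'M[F]_(size s) :=
  diag_mx (\row_(i < size s) s`_i).

(* Equality of classes in the Witt ring W(F) of nondegenerate forms A, B:
   [A] = [B] iff A _|_ (-B) is hyperbolic, i.e. (char <> 2) has a totally
   isotropic subspace of half its dimension. *)
Definition witt_eq (F : fieldType) (m1 m2 : nat) (A : 'M[F]_m1) (B : 'M[F]_m2) :=
  exists2 U : 'M[F]_(m1 + m2), ((\rank U).*2 = m1 + m2)%N &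
    U *m block_mx A 0 0 (- B) *m U^T = 0.

(* Springer residues of a diagonal form <a_0, ..., a_(n-1)> over K:          *)
(* write a_i = u_i pi^(v a_i) with u_i a unit; then                          *)
(*   d1 = <red u_i | v a_i even>,  d2 = <red u_i | v a_i odd>               *)
(* (since <u pi^(2m)> = <u> and <u pi^(2m+1)> = <u pi> in W(K)).            *)
Definition unit_part (K : fieldType) (v : K -> int) (pi : K) (x : K) : K :=
  x / pi ^ (v x).

Definition springer1 (K k : fieldType) (v : K -> int) (pi : K) (red : K -> k)
    (n : nat) (a : 'rV[K]_n) : seq k :=
  [seq red (unit_part v pi (a 0 i)) | i <- enum 'I_n & ~~ odd (absz (v (a 0 i)))].

Definition springer2 (K k : fieldType) (v : K -> int) (pi : K) (red : K -> k)
    (n : nat) (a : 'rV[K]_n) : seq k :=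
  [seq red (unit_part v pi (a 0 i)) | i <- enum 'I_n & odd (absz (v (a 0 i)))].

(* Main.v *)
(** Diagonalize q over R on a G-stable lattice L, with diagonal entries
    u_i pi^(e_i).  Rescaling the i-th basis vector by pi^(-floor(e_i / 2)) yields
    another G-stable lattice L1, namely the sum over m of (pi^m L' /\ pi^-m L)
    where L' is the dual of L; on it q is diagonal with entries u_i or u_i pi.
    Filtering L1 / pi L1 by the parity of the e_i, the form diag(u_i mod pi) is
    invariant on the associated graded module.  It represents d1(q) + d2(q),
    because a metabolic diagonal form over K has a metabolic residue form, and
    the module has the same composition factors as L / pi L.  Finally an
    invariant form on a module descends, up to Witt equivalence, to its
    semisimplification: split off a simple submodule W if it is nondegenerate,
    and otherwise pass to W^perp / W, the factors W and its dual carrying a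
    hyperbolic form. *)

Require Import Defs.
From HB Require Import structures.
From mathcomp Require Import all_boot all_order all_algebra.
From mathcomp Require Import perm zify ring.
Set Implicit Arguments. Unset Strict Implicit. Unset Printing Implicit Defensive.
Import Order.TTheory GRing.Theory Num.Theory.
Local Open Scope ring_scope.

(** * Modules and their semisimplifications *)

(** Traces lose multiplicities in characteristic p, and the basis [Q] in the statement is arbitrary.
    Composition factors are therefore compared through a relation [ssz], whose compatibility with
    short exact sequences is Jordan-Hoelder. The reductions of L and L1 are compared directly: both
    are filtered by the levels floor(e_i / 2), triangular in opposite directions, with equal graded
    pieces. The lattice L1 is stable because, for an isometry of diag(d) preserving L, the entry (i,
    j) has valuation at least max(0, e_i - e_j): stability of L gives the first bound, stability of
    its dual the second. On L1 the form degenerates mod pi at the indices with e_i odd; the missing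
    block comes from a companion lattice, with ceilings in place of floors and the form multiplied
    by pi. The statement allows any diagonalization of q, not only one adapted to L, so d1 + d2 has
    to be shown independent of it. Witt equivalence is always handled as a half-dimensional
    isotropic subspace of A _|_ (-B), so that neither Witt cancellation nor Witt decomposition
    enters. *)

Section Representations.
Variables (F : fieldType) (G : Type).

(* A module over the free algebra on G: no group law is imposed, so that
   submodules and quotients need no compatibility check. *)
Record rep := Rep { rdim : nat; act : G -> 'M[F]_rdim }.

Definition rhom (a b : rep) (X : 'M[F]_(rdim a, rdim b)) :=
  forall g, act a g *m X = X *m act b g.

Definition iso (a b : rep) :=
  exists X : 'M[F]_(rdim a, rdim b), [/\ rhom X, row_free X & row_full X].

Definition short_exact (a t b : rep) :=
  exists (i : 'M[F]_(rdim a, rdim t)) (p : 'M[F]_(rdim t, rdim b)),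
  [/\ rhom i /\ rhom p, row_free i, row_full p, i *m p = 0
    & (rdim a + rdim b)%N = rdim t].

Definition irr (t : rep) :=
  forall U : 'M[F]_(rdim t),
    (forall g, (U *m act t g <= U)%MS) -> U = 0 \/ row_full U.

Definition dsum (a b : rep) : rep :=
  Rep (fun g => block_mx (act a g) 0 0 (act b g)).

Lemma row_free_mul m n p (A : 'M[F]_(m, n)) (B : 'M_(n, p)) :
  row_free A -> row_free B -> row_free (A *m B).
Proof. by move=> fA fB; rewrite /row_free mxrankMfree. Qed.

Lemma row_full_mul m n p (A : 'M[F]_(m, n)) (B : 'M_(n, p)) :
  row_full A -> row_full B -> row_full (A *m B).
Proof.
move=> /row_fullP[A' A'A] /row_fullP[B' B'B]; apply/row_fullP.
by exists (B' *m A'); rewrite mulmxA -(mulmxA B') A'A mulmx1.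
Qed.

Lemma row_freeMl m n p (A : 'M[F]_(m, n)) (B : 'M_(n, p)) :
  row_free (A *m B) -> row_free A.
Proof.
by case/row_freeP=> C ABC; apply/row_freeP; exists (B *m C); rewrite mulmxA.
Qed.

Lemma row_fullMr m n p (A : 'M[F]_(m, n)) (B : 'M_(n, p)) :
  row_full (A *m B) -> row_full B.
Proof.
by case/row_fullP=> C CAB; apply/row_fullP; exists (C *m A); rewrite -mulmxA.
Qed.

Lemma row_full0 n (U : 'M[F]_n) : n = 0 -> row_full U.
Proof. by move=> n0; move: U; rewrite n0 => U; rewrite -col_leq_rank. Qed.

Lemma row_free_full_dim m n (A : 'M[F]_(m, n)) :
  row_free A -> row_full A -> m = n.
Proof. by move=> /eqP fA /eqP gA; rewrite -fA gA. Qed.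

Lemma row_free_dim_full m n (A : 'M[F]_(m, n)) :
  row_free A -> m = n -> row_full A.
Proof. by move=> /eqP fA mn; rewrite /row_full fA mn. Qed.

Lemma row_full_dim_free m n (A : 'M[F]_(m, n)) :
  row_full A -> m = n -> row_free A.
Proof. by move=> /eqP fA mn; rewrite /row_free fA mn. Qed.

Lemma rhom1 (a : rep) : @rhom a a 1%:M.
Proof. by move=> g; rewrite mul1mx mulmx1. Qed.

Lemma rhomM (a b c : rep) (X : 'M[F]_(rdim a, rdim b)) (Y : 'M[F]_(rdim b, rdim c)) :
  rhom X -> rhom Y -> @rhom a c (X *m Y).
Proof. by move=> hX hY g; rewrite mulmxA hX -mulmxA hY mulmxA. Qed.

Lemma rhom_cancel_free (a b c : rep) (X : 'M[F]_(rdim a, rdim b))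
    (Y : 'M[F]_(rdim b, rdim c)) :
  row_free Y -> rhom Y -> @rhom a c (X *m Y) -> rhom X.
Proof.
move=> fY hY hXY g; apply: (row_free_inj fY).
by rewrite -mulmxA hXY -!mulmxA hY.
Qed.

Lemma rhom_cancel_full (a b c : rep) (X : 'M[F]_(rdim a, rdim b))
    (Y : 'M[F]_(rdim b, rdim c)) :
  row_full X -> rhom X -> @rhom a c (X *m Y) -> rhom Y.
Proof.
move=> fX hX hXY g; apply: (row_full_inj fX).
by rewrite mulmxA -hX -mulmxA hXY mulmxA.
Qed.

Lemma iso_refl a : iso a a.
Proof.
by exists 1%:M; split; [exact: rhom1 | rewrite row_free_unit unitmx1
                        | rewrite row_full_unit unitmx1].
Qed.

Lemma iso_trans a b c : iso a b -> iso b c -> iso a c.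
Proof.
move=> [X [hX fX gX]] [Y [hY fY gY]]; exists (X *m Y).
by split; [exact: rhomM | exact: row_free_mul | exact: row_full_mul].
Qed.

Lemma iso_sym a b : iso a b -> iso b a.
Proof.
move=> [X [hX fX gX]]; exists (pinvmx X).
split; [|exact: pinvmx_free|exact: pinvmx_full].
apply: (@rhom_cancel_full a b a X) => //.
by rewrite mulmxVp //; apply: rhom1.
Qed.

Lemma iso_dim a b : iso a b -> rdim a = rdim b.
Proof. by move=> [X [_ fX gX]]; apply: row_free_full_dim fX gX. Qed.

Lemma row_free_block m1 m2 n1 n2 (A : 'M[F]_(m1, n1)) (B : 'M_(m2, n2)) :
  row_free A -> row_free B -> row_free (block_mx A 0 0 B).
Proof. by move=> /eqP fA /eqP fB; rewrite /row_free rank_diag_block_mx fA fB. Qed.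

Lemma row_full_block m1 m2 n1 n2 (A : 'M[F]_(m1, n1)) (B : 'M_(m2, n2)) :
  row_full A -> row_full B -> row_full (block_mx A 0 0 B).
Proof. by move=> /eqP fA /eqP fB; rewrite /row_full rank_diag_block_mx fA fB. Qed.

Lemma mulmx_diag_block m1 m2 n1 n2 p1 p2 (A : 'M[F]_(m1, n1)) (B : 'M_(m2, n2))
    (C : 'M_(n1, p1)) (D : 'M_(n2, p2)) :
  block_mx A 0 0 B *m block_mx C 0 0 D = block_mx (A *m C) 0 0 (B *m D).
Proof. by rewrite mulmx_block !(mulmx0, mul0mx, addr0, add0r). Qed.

Lemma iso_dsum a b c d : iso a c -> iso b d -> iso (dsum a b) (dsum c d).
Proof.
move=> [X [hX fX gX]] [Y [hY fY gY]]; exists (block_mx X 0 0 Y); split.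
- by move=> g /=; rewrite !mulmx_diag_block hX hY.
- exact: row_free_block.
- exact: row_full_block.
Qed.

Lemma col_mx_rhom a b t (X : 'M[F]_(rdim a, rdim t)) (Y : 'M[F]_(rdim b, rdim t)) :
  rhom X -> rhom Y -> @rhom (dsum a b) t (col_mx X Y).
Proof.
by move=> hX hY g /=; rewrite mul_block_col mul_col_mx !mul0mx addr0 add0r hX hY.
Qed.

Lemma isoP a b (X : 'M[F]_(rdim a, rdim b)) :
  rhom X -> row_free X -> rdim a = rdim b -> iso a b.
Proof. by move=> hX fX e; exists X; split=> //; exact: row_free_dim_full. Qed.

Lemma isoP_full a b (X : 'M[F]_(rdim a, rdim b)) :
  rhom X -> row_full X -> rdim a = rdim b -> iso a b.
Proof. by move=> hX fX e; exists X; split=> //; exact: row_full_dim_free. Qed.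

Lemma dsumC a b : iso (dsum a b) (dsum b a).
Proof.
pose X : 'M[F]_(rdim a + rdim b, rdim b + rdim a) := block_mx 0 1%:M 1%:M 0.
have XX : X *m block_mx 0 1%:M 1%:M 0 = 1%:M.
  by rewrite mulmx_block !(mulmx0, mul0mx, addr0, add0r, mulmx1) -scalar_mx_block.
apply: (@isoP (dsum a b) (dsum b a) X); last exact: addnC.
  by move=> g /=; rewrite !mulmx_block !(mulmx0, mul0mx, addr0, add0r, mulmx1, mul1mx).
by apply/row_freeP; exists (block_mx 0 1%:M 1%:M 0).
Qed.

Lemma dsum_interchange a b c d :
  iso (dsum (dsum a b) (dsum c d)) (dsum (dsum a c) (dsum b d)).
Proof.
pose X : 'M[F]_(rdim a + rdim b + (rdim c + rdim d),
                rdim a + rdim c + (rdim b + rdim d)) :=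
  block_mx (block_mx 1%:M 0 0 0) (block_mx 0 0 1%:M 0)
           (block_mx 0 1%:M 0 0) (block_mx 0 0 0 1%:M).
pose Y : 'M[F]_(rdim a + rdim c + (rdim b + rdim d),
                rdim a + rdim b + (rdim c + rdim d)) :=
  block_mx (block_mx 1%:M 0 0 0) (block_mx 0 0 1%:M 0)
           (block_mx 0 1%:M 0 0) (block_mx 0 0 0 1%:M).
have XX : X *m Y = 1%:M.
  rewrite /X /Y !mulmx_block !(mulmx0, mul0mx, addr0, add0r, mulmx1, add_block_mx).
  by rewrite -!(scalar_mx_block (rdim _)) !block_mx0 -scalar_mx_block.
apply: (@isoP (dsum (dsum a b) (dsum c d)) (dsum (dsum a c) (dsum b d)) X);
  last by rewrite /= addnACA.
  by move=> g /=; rewrite !mulmx_block !(mulmx0, mul0mx, addr0, add0r, mulmx1, mul1mx).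
by apply/row_freeP; exists Y.
Qed.

Lemma exact_ker a t b (i : 'M[F]_(rdim a, rdim t)) (p : 'M[F]_(rdim t, rdim b)) :
  row_free i -> row_full p -> i *m p = 0 -> (rdim a + rdim b)%N = rdim t ->
  (kermx p <= i)%MS.
Proof.
move=> /eqP fi /eqP gp /sub_kermxP ip e.
by rewrite -(geq_leqif (mxrank_leqif_sup ip)) mxrank_ker gp fi -e addnK.
Qed.

Lemma sub_rep (t : rep) m (U : 'M[F]_(m, rdim t)) :
  (forall g, (U *m act t g <= U)%MS) ->
  exists (a : rep) (i : 'M[F]_(rdim a, rdim t)),
    [/\ rhom i, row_free i, (i :=: U)%MS & rdim a = \rank U].
Proof.
move=> sU.
exists (Rep (fun g => row_base U *m act t g *m pinvmx (row_base U))), (row_base U).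
split=> //=; [move=> g /= | exact: row_base_free | exact: eq_row_base].
rewrite mulmxKpV // (eqmxMr _ (eq_row_base U)).
by apply: submx_trans (sU g) _; rewrite eq_row_base.
Qed.

Lemma ker_stable (t b : rep) (p : 'M[F]_(rdim t, rdim b)) g :
  rhom p -> (kermx p *m act t g <= kermx p)%MS.
Proof.
by move=> hp; apply/sub_kermxP; rewrite -mulmxA hp mulmxA mulmx_ker mul0mx.
Qed.

Lemma ker_rep (t b : rep) (p : 'M[F]_(rdim t, rdim b)) :
  rhom p ->
  exists (a : rep) (i : 'M[F]_(rdim a, rdim t)),
    [/\ rhom i, row_free i, i *m p = 0, (kermx p <= i)%MS
      & (rdim a + \rank p)%N = rdim t].
Proof.
move=> hp; have [a [i [hi fi ei da]]] := sub_rep (fun g => ker_stable g hp).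
exists a, i; split=> //; [by apply/sub_kermxP; rewrite ei|by rewrite ei|].
by rewrite da mxrank_ker subnK // rank_leq_row.
Qed.

(** The quotient action is read through a linear section [s] of [p]. The section need not be
    equivariant: the error [1%:M - p *m s] lands in the submodule [i], which [p] kills. *)
Lemma coker_rep (a t : rep) (i : 'M[F]_(rdim a, rdim t)) :
  rhom i ->
  exists (b : rep) (p : 'M[F]_(rdim t, rdim b)),
    [/\ rhom p, row_full p, i *m p = 0, (kermx p <= i)%MS
      & (\rank i + rdim b)%N = rdim t].
Proof.
move=> hi; set p := col_base (cokermx i).
have fp : row_full p by exact: col_base_full.
have ip : i *m p = 0.
  apply: (row_free_inj (row_base_free (cokermx i))).
  by rewrite mul0mx -mulmxA mulmx_base mulmx_coker.
have kp : (kermx p <= i)%MS.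
  rewrite submxE; apply/eqP.
  by rewrite -[cokermx i in X in _ *m X]mulmx_base mulmxA mulmx_ker mul0mx.
have /row_fullP[s sp] := fp; clearbody p.
exists (Rep (fun g => s *m act t g *m p)), p; split=> //=; last first.
  by rewrite mxrank_coker subnKC // rank_leq_col.
move=> g /=; have /submxP[D eD] : (1%:M - p *m s <= i)%MS.
  apply: submx_trans kp; apply/sub_kermxP.
  by rewrite mulmxBl mul1mx -mulmxA sp mulmx1 subrr.
apply/eqP; rewrite !mulmxA -subr_eq0 -{1}[act t g]mul1mx -!mulmxBl eD.
by rewrite -(mulmxA D) -hi -!mulmxA ip !mulmx0.
Qed.

Lemma exact_iso_mid a t b t' : short_exact a t b -> iso t t' -> short_exact a t' b.
Proof.
move=> [i [p [[hi hp] fi gp ip e]]] [X [hX fX gX]].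
exists (i *m X), (pinvmx X *m p); split.
- split; first exact: rhomM.
  by apply: (@rhom_cancel_full t t' b X) => //; rewrite mulmxA mulmxVp // mul1mx.
- exact: row_free_mul.
- by apply: row_full_mul; rewrite ?pinvmx_full.
- by rewrite -mulmxA (mulmxA X) mulmxVp // mul1mx.
- by rewrite e; apply: row_free_full_dim fX gX.
Qed.

Lemma exact_iso_sides a t b a' b' :
  short_exact a t b -> iso a' a -> iso b b' -> short_exact a' t b'.
Proof.
move=> [i [p [[hi hp] fi gp ip e]]] [X [hX fX gX]] [Y [hY fY gY]].
exists (X *m i), (p *m Y); split.
- by split; apply: rhomM.
- exact: row_free_mul.
- exact: row_full_mul.
- by rewrite -mulmxA (mulmxA i) ip mul0mx mulmx0.
- by rewrite (row_free_full_dim fX gX) -(row_free_full_dim fY gY).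
Qed.

Lemma exact_dsum a b : short_exact a (dsum a b) b.
Proof.
exists (row_mx 1%:M 0), (col_mx 0 1%:M); split=> //.
- split=> g /=.
    by rewrite mul_row_block mul_mx_row !(mulmx0, mul0mx, addr0, add0r, mulmx1, mul1mx).
  by rewrite mul_block_col mul_col_mx !(mulmx0, mul0mx, addr0, add0r, mulmx1, mul1mx).
- by apply/row_freeP; exists (col_mx 1%:M 0); rewrite mul_row_col mulmx1 mulmx0 addr0.
- by apply/row_fullP; exists (row_mx 0 1%:M); rewrite mul_row_col mulmx1 mul0mx add0r.
- by rewrite mul_row_col mulmx0 mul0mx addr0.
Qed.

(* Zassenhaus butterfly of two submodules a, u of t: x = a /\ u. *)
Lemma exact_refine a t b u w : short_exact a t b -> short_exact u t w ->
  exists x y z r, [/\ short_exact x a y, short_exact z b r, short_exact x u z & short_exact y w r].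
Proof.
move=> [i [p [[hi hp] fi gp ip eab]]] [j [q [[hj hq] fj gq jq euw]]].
have hiq : rhom (i *m q) by exact: rhomM.
have [x [kx [hkx fkx kxiq skx ex]]] := ker_rep hiq.
(* Here [y] is the image of [a] in [w] and [r] is [w / y]; [z] will be the kernel of the map
   [b -> r] induced on the quotient. *)
have [r [c [hc gc iqc skc er]]] := coker_rep hiq.
have [y [e [hE fe ee ey]]] := sub_rep (U := i *m q)
  (fun g => eq_ind _ (fun M => (M <= i *m q)%MS) (submxMl _ _) _ (hiq g)).
have /submxP[s es] : (i *m q <= e)%MS by rewrite ee.
have hs : @rhom a y s by apply: rhom_cancel_free fe hE _; rewrite -es.
have gs : row_full s.
  by have := mxrankM_maxl s e; rewrite -es -ey col_leq_rank.
have ec : e *m c = 0 by apply: (row_full_inj gs); rewrite mulmxA -es iqc mulmx0.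
have xay : short_exact x a y.
  exists kx, s; split=> //; last by rewrite ey.
  by apply: (row_free_inj fe); rewrite -mulmxA -es kxiq mul0mx.
have ywr : short_exact y w r by exists e, c; split=> //; rewrite ey.
(* The map [q *m c] vanishes on [i], hence factors as [p *m h]. A factor on the left is an inclusion
   of column spaces, whence the transposes. *)
have /submxP[h' eh'] : ((q *m c)^T <= p^T)%MS.
  rewrite submxE; apply/eqP/trmx_inj; rewrite trmx0 trmx_mul trmxK.
  have /submxP[D eD] : ((cokermx p^T)^T <= i)%MS.
    apply: submx_trans (exact_ker fi gp ip eab); apply/sub_kermxP.
    by apply: trmx_inj; rewrite trmx_mul trmxK mulmx_coker trmx0.
  by rewrite eD -mulmxA (mulmxA i) iqc mulmx0.
pose h := h'^T; have eh : q *m c = p *m h.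
  by apply: trmx_inj; rewrite eh' trmx_mul trmxK.
have hh : @rhom b r h by apply: rhom_cancel_full gp hp _; rewrite -eh; apply: rhomM.
have gh : row_full h.
  by apply: (@row_fullMr _ _ _ p); rewrite -eh; apply: row_full_mul.
have [z [kz [hkz fkz kzh skz ez]]] := ker_rep hh.
have zbr : short_exact z b r.
  exists kz, h; split=> //; apply/eqP.
  by rewrite -ez eqn_add2l eq_sym.
have /submxP[l el] : (kx *m i <= j)%MS.
  apply: submx_trans (exact_ker fj gq jq euw); apply/sub_kermxP.
  by rewrite -mulmxA kxiq.
have /submxP[m em] : (j *m p <= kz)%MS.
  apply: submx_trans skz; apply/sub_kermxP.
  by rewrite -mulmxA -eh mulmxA jq mul0mx.
have fl : row_free l by apply: (@row_freeMl _ _ _ _ j); rewrite -el row_free_mul.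
have hl : @rhom x u l by apply: rhom_cancel_free fj hj _; rewrite -el; apply: rhomM.
have hm : @rhom u z m by apply: rhom_cancel_free fkz hkz _; rewrite -em; apply: rhomM.
have lm : l *m m = 0.
  apply: (row_free_inj fkz).
  by rewrite -mulmxA -em mulmxA -el -mulmxA ip mulmx0 mul0mx.
have kml : (kermx m <= l)%MS.
  have /submxP[v1 e1] : (kermx m *m j <= i)%MS.
    apply: submx_trans (exact_ker fi gp ip eab); apply/sub_kermxP.
    by rewrite -mulmxA em mulmxA mulmx_ker mul0mx.
  have /submxP[v2 e2] : (v1 <= kx)%MS.
    apply: submx_trans skx; apply/sub_kermxP.
    by rewrite mulmxA -e1 -mulmxA jq mulmx0.
  apply/submxP; exists v2; apply: (row_free_inj fj).
  by rewrite e1 e2 -!mulmxA el.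
have exz : (rdim x + rdim z)%N = rdim u.
  have [_ [_ [_ _ _ _ exy]]] := xay; have [_ [_ [_ _ _ _ eyr]]] := ywr.
  have [_ [_ [_ _ _ _ ezr]]] := zbr.
  apply/eqP; rewrite -(eqn_add2r (rdim w)) euw -eab -exy -eyr -ezr.
  by apply/eqP; rewrite addnACA.
exists x, y, z, r; split=> //; exists l, m; split=> //.
rewrite -col_leq_rank -(leq_add2l (rdim x)) exz -leq_subLR.
by have := mxrankS kml; rewrite mxrank_ker (eqP fl) leq_subCl leq_subLR addnC -leq_subLR.
Qed.

(* [ssz t s]: the module s is a semisimplification of t.  The zero module
   satisfies [irr]. *)
Inductive ssz : rep -> rep -> Prop :=
| ssz_irr t s : irr t -> iso t s -> ssz t s
| ssz_ext a t b s1 s2 s : short_exact a t b -> ssz a s1 -> ssz b s2 ->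
    iso (dsum s1 s2) s -> ssz t s.

Lemma iso_irr a b : iso a b -> irr a -> irr b.
Proof.
move=> [X [hX fX gX]] ia U sU.
have e : rdim a = rdim b by exact: row_free_full_dim fX gX.
have [XY YX] := (mulmxVp fX, mulVpmx gX); move: (pinvmx X) XY YX => Y XY YX.
have [g|z|full] := ia (X *m U *m Y).
- have /submxP[D eD] := sU g; apply/submxP; exists (X *m D *m Y).
  have hY : rhom Y.
    by apply: (@rhom_cancel_full a b a X) => //; rewrite XY; apply: rhom1.
  by rewrite -mulmxA -hY mulmxA -(mulmxA X U) eD -!mulmxA (mulmxA _ X) YX mul1mx.
- left; move/(congr1 (fun M => Y *m M *m X)): z.
  by rewrite !mulmxA YX mul1mx -mulmxA YX mulmx1 mulmx0 mul0mx.
right; move/eqP: full => rk; apply/eqP.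
have : (rdim a <= \rank U)%N.
  by rewrite -{1}rk -mulmxA (leq_trans (mxrankM_maxr _ _)) // mxrankM_maxl.
by rewrite e => le; apply/eqP; rewrite eqn_leq le rank_leq_col.
Qed.

Lemma ssz_isor t s s' : ssz t s -> iso s s' -> ssz t s'.
Proof.
move=> ts; case: ts s' => [{}t {}s it i s' i'|a {}t b s1 s2 {}s E A B i s' i'].
  by apply: ssz_irr it _; apply: iso_trans i i'.
by apply: ssz_ext E A B _; apply: iso_trans i i'.
Qed.

Lemma ssz_isol t t' s : iso t t' -> ssz t s -> ssz t' s.
Proof.
move=> i ts; case: ts i => [{}t {}s it i' i|a {}t b s1 s2 {}s E A B i' i].
  by apply: ssz_irr (iso_irr i it) _; apply: iso_trans (iso_sym i) i'.
exact: ssz_ext (exact_iso_mid E i) A B i'.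
Qed.

Lemma exact0l a t b : short_exact a t b -> rdim a = 0 -> iso t b.
Proof.
move=> [i [p [[hi hp] fi gp ip e]]] a0.
by apply: (isoP_full hp gp); rewrite -e a0.
Qed.

Lemma exact0r a t b : short_exact a t b -> rdim b = 0 -> iso a t.
Proof.
move=> [i [p [[hi hp] fi gp ip e]]] b0.
by apply: (isoP hi fi); rewrite -e b0 addn0.
Qed.

Lemma irr0 a : rdim a = 0 -> irr a.
Proof. by move=> a0 U _; right; apply: row_full0. Qed.

Lemma irr_exact a t b : irr t -> short_exact a t b -> rdim a = 0 \/ rdim b = 0.
Proof.
move=> it [i [p [[hi hp] fi gp ip e]]].
have [g|k0|kf] := it (kermx p); first exact: ker_stable.
  left; move/eqP: k0; rewrite -mxrank_eq0 mxrank_ker (eqP gp) -e.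
  by rewrite addnK => /eqP.
right; move: kf; rewrite /row_full mxrank_ker (eqP gp) -e addnK.
by rewrite -{1}(addn0 (rdim a)) eqn_add2l eq_sym => /eqP.
Qed.

(** Since the zero module satisfies [irr], a derivation for an irreducible module may still end with
    [ssz_ext]; one of the two sides is then zero. *)
Lemma ssz_irr_iso t s : ssz t s -> irr t -> iso t s.
Proof.
elim=> {t s} [//|a t b s1 s2 s E A IA B IB i it].
have [a0|b0] := irr_exact it E.
  have tb := exact0l E a0.
  apply: iso_trans (tb) _; apply: iso_trans (IB (iso_irr tb it)) _.
  apply: iso_trans i; apply: iso_sym; apply: exact0l (exact_dsum _ _) _.
  by rewrite -(iso_dim (IA (irr0 a0))).
have ta := exact0r E b0.
apply: iso_trans (iso_sym ta) _; apply: iso_trans (IA (iso_irr (iso_sym ta) it)) _.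
apply: iso_trans i; apply: exact0r (exact_dsum _ _) _.
by rewrite -(iso_dim (IB (irr0 b0))).
Qed.

(** Jordan-Hoelder, by induction on the derivation: the new sequence is refined against the one used
    last, and the four resulting pieces are regrouped. *)
Lemma ssz_exact t s : ssz t s -> forall u w, short_exact u t w ->
  exists s1 s2, [/\ ssz u s1, ssz w s2 & iso (dsum s1 s2) s].
Proof.
elim=> {t s} [t s it i u w E|a t b s1 s2 s E A IA B IB i u w E'].
  have [u0|w0] := irr_exact it E.
    have tw := exact0l E u0; exists u, w; split.
    - by apply: ssz_irr (irr0 u0) (iso_refl u).
    - by apply: ssz_irr (iso_irr tw it) (iso_refl w).
    apply: iso_trans (exact0l (exact_dsum _ _) u0) _.
    exact: iso_trans (iso_sym tw) i.
  have ut := exact0r E w0; exists u, w; split.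
  - by apply: ssz_irr (iso_irr (iso_sym ut) it) (iso_refl u).
  - by apply: ssz_irr (irr0 w0) (iso_refl w).
  apply: iso_trans (iso_sym (exact0r (exact_dsum _ _) w0)) _.
  exact: iso_trans ut i.
have [x [y [z [r [exy ezr exz eyr]]]]] := exact_refine E E'.
have [sx [sy [X Y ixy]]] := IA _ _ exy.
have [sz [sr [Z R izr]]] := IB _ _ ezr.
exists (dsum sx sz), (dsum sy sr); split.
- exact: ssz_ext exz X Z (iso_refl _).
- exact: ssz_ext eyr Y R (iso_refl _).
apply: iso_trans (dsum_interchange _ _ _ _) _.
exact: iso_trans (iso_dsum ixy izr) i.
Qed.

Definition ssz_eq t t' := forall s, ssz t s <-> ssz t' s.

(** The extension class is invisible to the semisimplification; modules on different lattices are
    compared in this form. *)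
Lemma exact_ssz_eq a t b t' : short_exact a t b -> short_exact a t' b -> ssz_eq t t'.
Proof.
by move=> E E' s; split=> /ssz_exact H;
  [have [s1 [s2 [A B i]]] := H _ _ E; apply: ssz_ext E' A B i
  |have [s1 [s2 [A B i]]] := H _ _ E'; apply: ssz_ext E A B i].
Qed.

End Representations.

(** * Filtrations by sets of coordinates *)

Section Filtrations.
Variables (F : fieldType) (G : Type) (n : nat).
Implicit Types (I J K : {set 'I_n}) (tau : G -> 'M[F]_n).

Definition selmx I : 'M[F]_(#|I|, n) := \matrix_(i, j) (enum_val i == j)%:R.

Lemma mul_selE p I (A : 'M_(n, p)) i j : (selmx I *m A) i j = A (enum_val i) j.
Proof.
rewrite mxE (bigD1 (enum_val i)) //= mxE eqxx mul1r big1 ?addr0 // => l ne.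
by rewrite mxE eq_sym (negPf ne) mul0r.
Qed.

Lemma mul_selTE p I (A : 'M_(p, n)) i j : (A *m (selmx I)^T) i j = A i (enum_val j).
Proof. by rewrite -[A]trmxK -trmx_mul mxE mul_selE !mxE. Qed.

Lemma selTselE p I (A : 'M_(p, n)) i j :
  (A *m (selmx I)^T *m selmx I) i j = if j \in I then A i j else 0.
Proof.
rewrite mxE; under eq_bigr => l _ do rewrite mul_selTE mxE.
case: ifP => jI.
  rewrite (bigD1 (enum_rank_in jI j)) //= enum_rankK_in // eqxx mulr1.
  rewrite big1 ?addr0 // => l ne; case: eqP => [e|]; last by rewrite mulr0.
  by case/eqP: ne; apply: enum_val_inj; rewrite enum_rankK_in.
by rewrite big1 // => l _; case: eqP => [e|]; rewrite ?mulr0 // -e enum_valP in jI *.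
Qed.

Lemma selmxM I J i j : (selmx I *m (selmx J)^T) i j = (enum_val i == enum_val j)%:R.
Proof. by rewrite mul_selTE mxE. Qed.

Lemma selmxK I : selmx I *m (selmx I)^T = 1%:M.
Proof. by apply/matrixP => i j; rewrite selmxM mxE (inj_eq enum_val_inj). Qed.

Lemma sel_disjoint I J : [disjoint I & J] -> selmx I *m (selmx J)^T = 0.
Proof.
move=> dIJ; apply/matrixP => i j; rewrite selmxM mxE; case: eqP => // e.
by have := disjointFr dIJ (enum_valP i); rewrite e enum_valP.
Qed.

Lemma sel_sub I K : I \subset K -> selmx I *m (selmx K)^T *m selmx K = selmx I.
Proof.
move=> /subsetP sIK; apply/matrixP => i j; rewrite selTselE.
case: ifPn => // jK; rewrite mxE; case: eqP => // e.
by rewrite -e sIK ?enum_valP in jK.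
Qed.

(** The principal block of [tau] on [I]. It makes sense for every set of indices, and becomes a
    submodule or quotient only under the vanishing conditions of the lemmas below. *)
Definition restr tau I : rep F G := Rep (fun g => selmx I *m tau g *m (selmx I)^T).

Lemma restr_eq tau tau' I :
  (forall g i j, i \in I -> j \in I -> tau g i j = tau' g i j) ->
  iso (restr tau I) (restr tau' I).
Proof.
move=> e; exists 1%:M; split.
- move=> g; rewrite mul1mx mulmx1; apply/matrixP => i j.
  by rewrite /= !mul_selTE !mul_selE e ?enum_valP.
- by rewrite row_free_unit unitmx1.
- by rewrite row_full_unit unitmx1.
Qed.

Lemma rep_eq_iso tau tau' : (forall g, tau g = tau' g) -> iso (Rep tau) (Rep tau').
Proof.
move=> e; exists 1%:M; split; rewrite ?row_free_unit ?row_full_unit ?unitmx1 //.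
by move=> g; rewrite mul1mx mulmx1 /= e.
Qed.

Lemma sub_restr_hom tau I K : I \subset K ->
  (forall g i j, i \in I -> j \in K -> j \notin I -> tau g i j = 0) ->
  @rhom F G (restr tau I) (restr tau K) (selmx I *m (selmx K)^T).
Proof.
move=> sIK z g; rewrite /= !mulmxA sel_sub //.
apply/matrixP => i j; rewrite !mul_selTE selTselE; case: ifPn => // jI.
by rewrite mul_selE z ?enum_valP.
Qed.

Lemma restr_exact tau I K : I \subset K ->
  (forall g i j, i \in I -> j \in K -> j \notin I -> tau g i j = 0) ->
  short_exact (restr tau I) (restr tau K) (restr tau (K :\: I)).
Proof.
move=> sIK z; have sJK : K :\: I \subset K by exact: subsetDl.
exists (selmx I *m (selmx K)^T), (selmx K *m (selmx (K :\: I))^T); split.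
- split; first exact: sub_restr_hom.
  move=> g /=; apply: trmx_inj; rewrite !trmx_mul !trmxK !mulmxA sel_sub //.
  apply/matrixP => i j; rewrite !mul_selTE selTselE; case: ifPn => //.
  rewrite inE enum_valP andbT negbK => jI.
  by rewrite mul_selE mxE z //; have := enum_valP i; rewrite inE => /andP[].
- by apply/row_freeP; exists (selmx K *m (selmx I)^T); rewrite mulmxA sel_sub ?selmxK.
- by apply/row_fullP; exists (selmx (K :\: I) *m (selmx K)^T); rewrite mulmxA sel_sub ?selmxK.
- rewrite mulmxA sel_sub // sel_disjoint //.
  by apply/pred0P => x /=; rewrite inE; case: (x \in I).
- by rewrite /= (cardsD K I) (setIidPr sIK) subnKC // subset_leq_card.
Qed.

Lemma restr_split tau I K : I \subset K ->
  (forall g i j, i \in I -> j \in K :\: I -> tau g i j = 0) ->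
  (forall g i j, i \in K :\: I -> j \in I -> tau g i j = 0) ->
  iso (dsum (restr tau I) (restr tau (K :\: I))) (restr tau K).
Proof.
move=> sIK z z'; have sJK : K :\: I \subset K by exact: subsetDl.
have dIJ : selmx I *m (selmx (K :\: I))^T = 0.
  by rewrite sel_disjoint //; apply/pred0P => x /=; rewrite inE; case: (x \in I).
apply: (@isoP F G (dsum (restr tau I) (restr tau (K :\: I))) (restr tau K)
          (col_mx (selmx I *m (selmx K)^T) (selmx (K :\: I) *m (selmx K)^T))).
- apply: col_mx_rhom; apply: sub_restr_hom => // g i j iI jK jI; first by apply: z; rewrite ?inE ?jI.
  by apply: z' => //; rewrite inE jK andbT negbK in jI.
- apply/row_freeP; exists (row_mx (selmx K *m (selmx I)^T) (selmx K *m (selmx (K :\: I))^T)).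
  rewrite mul_col_row !mulmxA !sel_sub // !selmxK dIJ.
  have -> : selmx (K :\: I) *m (selmx I)^T = 0.
    by apply: trmx_inj; rewrite trmx_mul trmxK dIJ trmx0.
  by rewrite -scalar_mx_block.
- by rewrite /= (cardsD K I) (setIidPr sIK) subnKC // subset_leq_card.
Qed.

Lemma restrT tau : iso (restr tau setT) (Rep tau).
Proof.
apply: (@isoP F G (restr tau setT) (Rep tau) (selmx setT)).
- by move=> g /=; apply/matrixP => i j; rewrite selTselE inE.
- by apply/row_freeP; exists (selmx setT)^T; rewrite selmxK.
- by rewrite /= cardsT card_ord.
Qed.

Lemma tri_exact tau I :
  (forall g i j, i \in I -> j \notin I -> tau g i j = 0) ->
  short_exact (restr tau I) (Rep tau) (restr tau (~: I)).
Proof.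
move=> z; rewrite -setTD; apply: exact_iso_mid (restrT tau).
by apply: restr_exact => [|g i j iI _ jI]; rewrite ?subsetT ?z.
Qed.

Lemma ssz_eq_tri tau tau' I :
  (forall g i j, i \in I -> j \notin I -> tau g i j = 0) ->
  (forall g i j, i \in I -> j \notin I -> tau' g i j = 0) ->
  (forall g i j, (i \in I) = (j \in I) -> tau g i j = tau' g i j) ->
  ssz_eq (Rep tau) (Rep tau').
Proof.
move=> z z' e; apply: exact_ssz_eq (tri_exact z) _.
apply: exact_iso_sides (tri_exact z') _ _.
  by apply: restr_eq => g i j iI jI; rewrite e ?iI ?jI.
apply: restr_eq => g i j; rewrite !inE => iI jI.
by rewrite e // (negPf iI) (negPf jI).
Qed.

Lemma ssz_eq_trans (a b c : rep F G) : ssz_eq a b -> ssz_eq b c -> ssz_eq a c.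
Proof. by move=> ab bc s; rewrite ab bc. Qed.

Lemma ssz_eq_sym (a b : rep F G) : ssz_eq a b -> ssz_eq b a.
Proof. by move=> ab s; rewrite ab. Qed.

Lemma iso_ssz_eq (a b : rep F G) : iso a b -> ssz_eq a b.
Proof.
by move=> i s; split; [exact: ssz_isol | apply: ssz_isol; exact: iso_sym].
Qed.

Definition graded (h : 'I_n -> nat) tau g : 'M[F]_n :=
  \matrix_(i, j) (if h i == h j then tau g i j else 0).

(** The part off the diagonal blocks is erased one level of [h] at a time, and each erasure changes
    only how two fixed modules are extended. *)
Lemma filtered_ssz_eq h tau :
  (forall g i j, (h i < h j)%N -> tau g i j = 0) ->
  ssz_eq (Rep tau) (Rep (graded h tau)).
Proof.
move=> z.
(* In [t m] the levels below [m] are already split off, and [tau] is untouched among the levels at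
   least [m]. *)
pose t m g : 'M[F]_n :=
  \matrix_(i, j) (if (h i == h j) || (m <= h i)%N && (m <= h j)%N then tau g i j else 0).
have step m : ssz_eq (Rep tau) (Rep (t m)).
  elim: m => [|m IHm].
    by apply/iso_ssz_eq/rep_eq_iso => g; apply/matrixP => i j; rewrite mxE !leq0n orbT.
  apply: ssz_eq_trans IHm _; apply: (@ssz_eq_tri _ _ [set i | h i <= m]%N).
  - move=> g i j; rewrite !inE -ltnNge mxE => hi hj.
    by rewrite z ?if_same // (leq_ltn_trans hi).
  - move=> g i j; rewrite !inE -ltnNge mxE => hi hj.
    by rewrite z ?if_same // (leq_ltn_trans hi).
  move=> g i j; rewrite !inE !mxE => e; congr (if _ then _ else _); lia.
apply: ssz_eq_trans (step (\max_i h i).+1) _.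
apply/iso_ssz_eq/rep_eq_iso => g; apply/matrixP => i j; rewrite !mxE.
by rewrite ltnNge leq_bigmax orbF.
Qed.

Lemma filtered_ssz_eq_rev h tau :
  (forall g i j, (h j < h i)%N -> tau g i j = 0) ->
  ssz_eq (Rep tau) (Rep (graded h tau)).
Proof.
move=> z; pose h' i := (\max_i h i - h i)%N.
have lh i : (h i <= \max_i h i)%N by exact: leq_bigmax.
apply: ssz_eq_trans (@filtered_ssz_eq h' tau _) _.
  move=> g i j hij; apply: z; move: hij (lh i) (lh j); rewrite /h'; lia.
apply/iso_ssz_eq/rep_eq_iso => g; apply/matrixP => i j; rewrite !mxE.
congr (if _ then _ else _); move: (lh i) (lh j); rewrite /h'; lia.
Qed.

(** A direct sum of irreducible blocks is assembled one level at a time; levels not attained by [h]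
    contribute the zero module, which is [irr]. *)
Lemma graded_ssz (h : 'I_n -> nat) tau :
  (forall g i j, h i != h j -> tau g i j = 0) ->
  (forall b, irr (restr tau [set i | h i == b])) ->
  ssz (Rep tau) (Rep tau).
Proof.
move=> z irrb.
have step m : ssz (restr tau [set i | h i < m]%N) (restr tau [set i | h i < m]%N).
  elim: m => [|m IHm].
    apply: ssz_irr (iso_refl _); apply: irr0 => /=.
    by apply/eqP; rewrite cards_eq0; apply/eqP/setP => i; rewrite !inE.
  have sub : [set i | h i < m]%N \subset [set i | h i < m.+1]%N.
    by apply/subsetP => i; rewrite !inE; apply: leqW.
  have dif : [set i | h i < m.+1]%N :\: [set i | h i < m]%N = [set i | h i == m].
    by apply/setP => i; rewrite !inE; lia.
  apply: ssz_ext (restr_exact sub _) IHm (ssz_irr _ (iso_refl _)) (restr_split sub _ _).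
  - by move=> g i j; rewrite !inE => hi hj hj'; apply: z; lia.
  - by rewrite dif; apply: irrb.
  - by move=> g i j; rewrite dif !inE => hi hj; apply: z; lia.
  - by move=> g i j; rewrite dif !inE => hi hj; apply: z; lia.
have := step (\max_i h i).+1.
have -> : [set i | h i < (\max_i h i).+1]%N = setT.
  by apply/setP => i; rewrite !inE ltnS leq_bigmax.
move=> S; apply: ssz_isol (restrT tau) _; apply: ssz_isor S (restrT tau).
Qed.

Lemma base_change_iso tau (Q : 'M[F]_n) : Q \in unitmx ->
  iso (Rep (fun g => Q *m tau g *m invmx Q)) (Rep tau).
Proof.
move=> uQ; exists Q; rewrite row_free_unit row_full_unit uQ; split=> // g /=.
by rewrite mulmxKV.
Qed.

(** Bridge from the matrix description of a composition series to [ssz]: in the basis [Q] the action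
    is triangular for [blk], and its diagonal blocks are irreducible. *)
Lemma composition_ssz tau Q blk : composition_data tau Q blk ->
  ssz (Rep tau) (Rep (graded_rep tau Q blk)).
Proof.
case=> uQ tri irrQ.
suff S : ssz (Rep (graded_rep tau Q blk)) (Rep (graded_rep tau Q blk)).
  apply: ssz_isol (base_change_iso tau uQ) _.
  by apply/(filtered_ssz_eq (h := blk)) => // g i j; apply: tri.
apply: (@graded_ssz blk) => [g i j ne|b U sU]; first by rewrite mxE (negPf ne).
set I := [set i | blk i == b] in U sU *.
have cI : #|[pred i | blk i == b]| = #|I| by apply: eq_card => i; rewrite !inE.
have zI g : selmx I *m graded_rep tau Q blk g *m (selmx I)^T *m selmx I
          = selmx I *m graded_rep tau Q blk g.
  apply/matrixP => i j; rewrite selTselE; case: ifPn => // jI.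
  rewrite mul_selE mxE; case: eqP => // e.
  by have := enum_valP i; rewrite !inE in jI *; rewrite e (negPf jI).
have rk : \rank U = \rank ((selmx I)^T *m U *m selmx I).
  apply/eqP; rewrite eqn_leq; apply/andP; split; last first.
    by rewrite -mulmxA (leq_trans (mxrankM_maxr _ _)) // mxrankM_maxl.
  have {1}-> : U = selmx I *m ((selmx I)^T *m U *m selmx I) *m (selmx I)^T.
    by rewrite !mulmxA selmxK mul1mx -mulmxA selmxK mulmx1.
  by rewrite (leq_trans (mxrankM_maxl _ _)) // mxrankM_maxr.
(* [composition_data] tests square matrices of size [n] supported on the columns of the block, so
   the submodule [U] of the block is extended by zero. *)
have [i j ne|g|z|full] := irrQ b ((selmx I)^T *m U *m selmx I).
- have jI : j \notin I by rewrite inE.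
  have -> : (selmx I)^T *m U *m selmx I = (selmx I)^T *m U *m selmx I *m (selmx I)^T *m selmx I.
    by rewrite -!mulmxA (mulmxA (selmx I)) selmxK mul1mx.
  by rewrite selTselE (negPf jI).
- have /submxP[D eD] := sU g; rewrite /= in eD.
  apply/submxP; exists ((selmx I)^T *m D *m selmx I).
  rewrite !mulmxA -(mulmxA _ (selmx I) (selmx I)^T) selmxK mulmx1 -(mulmxA _ D U) -eD.
  by rewrite -!mulmxA -(zI g) !mulmxA.
- by left; apply/eqP; rewrite -mxrank_eq0 rk z mxrank0.
- by right; rewrite /row_full rk full cI.
Qed.

End Filtrations.

(** * Witt equivalence *)

Section Witt.
Variable F : fieldType.

(** The rows of [row_mx X Y] are a basis of a lagrangian of A _|_ (-B). Keeping the two components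
    of a basis apart makes graphs and direct sums explicit; [witt_wittE] returns to [witt_eq]. *)
Definition witt n1 n2 (A : 'M[F]_n1) (B : 'M[F]_n2) :=
  exists m (X : 'M_(m, n1)) (Y : 'M_(m, n2)),
  [/\ X *m A *m X^T = Y *m B *m Y^T, row_free (row_mx X Y)
    & (m.*2 = n1 + n2)%N].

Lemma isotropic_rank m n (S : 'M[F]_n) (U : 'M_(m, n)) :
  S \in unitmx -> U *m S *m U^T = 0 -> ((\rank U).*2 <= n)%N.
Proof.
move=> uS; rewrite -mulmxA => /sub_kermxP/mxrankS.
rewrite mxrank_ker -(mxrank_tr (S *m _)) trmx_mul trmxK mxrankMfree; last first.
  by rewrite row_free_unit unitmx_tr.
by move: (rank_leq_col U); lia.
Qed.

Lemma mul_row_diag_block m n1 n2 (X : 'M[F]_(m, n1)) (Y : 'M_(m, n2)) A B :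
  row_mx X Y *m block_mx A 0 0 (- B) *m (row_mx X Y)^T =
  X *m A *m X^T - Y *m B *m Y^T.
Proof.
rewrite mul_row_block !mulmx0 addr0 add0r mulmxN tr_row_mx mul_row_col.
by rewrite mulNmx.
Qed.

Lemma witt_wittE n1 n2 (A : 'M[F]_n1) (B : 'M_n2) : witt A B <-> witt_eq A B.
Proof.
split=> [[m [X [Y [e fXY em]]]]|[U rk iU]].
  exists <<row_mx X Y>>%MS; first by rewrite mxrank_gen (eqP fXY).
  have /submxP[D ->] : (<<row_mx X Y>> <= row_mx X Y)%MS by rewrite genmxE.
  rewrite trmx_mul -!mulmxA (mulmxA (row_mx X Y)) (mulmxA _ (row_mx X Y)^T).
  by rewrite mul_row_diag_block e subrr mul0mx mulmx0.
exists (\rank U), (lsubmx (row_base U)), (rsubmx (row_base U)).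
rewrite hsubmxK row_base_free; split=> //; apply/eqP; rewrite -subr_eq0.
rewrite -mul_row_diag_block hsubmxK.
have /submxP[D ->] : (row_base U <= U)%MS by rewrite eq_row_base.
rewrite trmx_mul -!mulmxA (mulmxA U) (mulmxA _ U^T) iU.
by rewrite mul0mx mulmx0.
Qed.

Lemma row_free_row_mxl m n1 n2 (X : 'M[F]_(m, n1)) (Y : 'M_(m, n2)) :
  row_free X -> row_free (row_mx X Y).
Proof.
case/row_freeP=> X' XX; apply/row_freeP; exists (col_mx X' 0).
by rewrite mul_row_col mulmx0 addr0.
Qed.

Lemma row_free_row_mxr m n1 n2 (X : 'M[F]_(m, n1)) (Y : 'M_(m, n2)) :
  row_free Y -> row_free (row_mx X Y).
Proof.
case/row_freeP=> Y' YY; apply/row_freeP; exists (col_mx 0 Y').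
by rewrite mul_row_col mulmx0 add0r.
Qed.

Lemma witt_congr n1 n2 (A : 'M[F]_n1) (B : 'M_n2) (X : 'M_(n2, n1)) :
  n1 = n2 -> X *m A *m X^T = B -> witt A B.
Proof.
move=> e XA; exists n2, X, 1%:M; split; last by rewrite e addnn.
  by rewrite mul1mx trmx1 mulmx1.
by rewrite row_free_row_mxr // row_free_unit unitmx1.
Qed.

Lemma row_free_row_mxC m n1 n2 (X : 'M[F]_(m, n1)) (Y : 'M_(m, n2)) :
  row_free (row_mx X Y) -> row_free (row_mx Y X).
Proof.
case/row_freeP=> Z; rewrite -[Z]vsubmxK mul_row_col => e.
by apply/row_freeP; exists (col_mx (dsubmx Z) (usubmx Z)); rewrite mul_row_col addrC.
Qed.

Lemma witt_sym n1 n2 (A : 'M[F]_n1) (B : 'M_n2) : witt A B -> witt B A.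
Proof.
move=> [m [X [Y [e f em]]]]; exists m, Y, X; split=> //.
  exact: row_free_row_mxC.
by rewrite addnC.
Qed.

Lemma witt_block n1 n2 n3 n4 (A : 'M[F]_n1) (B : 'M_n2) (C : 'M_n3) (D : 'M_n4) :
  witt A B -> witt C D -> witt (block_mx A 0 0 C) (block_mx B 0 0 D).
Proof.
move=> [m [X [Y [e f em]]]] [m' [X' [Y' [e' f' em']]]].
exists (m + m')%N, (block_mx X 0 0 X'), (block_mx Y 0 0 Y'); split; last first.
- by rewrite doubleD em em' addnACA.
- apply: inj_row_free => v; rewrite -[v]hsubmxK mul_mx_row !mul_row_block.
  rewrite !mulmx0 !addr0 !add0r => h.
  have [h1 h2] := eq_row_mx (etrans h (esym (row_mx0 _ _ _ _))).
  have [h3 h4] := eq_row_mx (etrans h1 (esym (row_mx0 _ _ _ _))).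
  have [h5 h6] := eq_row_mx (etrans h2 (esym (row_mx0 _ _ _ _))).
  have -> : lsubmx v = 0.
    by apply: (row_free_inj f); rewrite mul0mx mul_mx_row h3 h5 row_mx0.
  have -> : rsubmx v = 0.
    by apply: (row_free_inj f'); rewrite mul0mx mul_mx_row h4 h6 row_mx0.
  exact: row_mx0.
- by rewrite !tr_block_mx !trmx0 !mulmx_diag_block e e'.
Qed.

Lemma witt_metabolic m n d (A : 'M[F]_n) (H : 'M[F]_d) (L : 'M_(m, d)) :
  row_free L -> m.*2 = d -> L *m H *m L^T = 0 -> witt (block_mx A 0 0 H) A.
Proof.
move=> fL dm LH; exists (n + m)%N, (block_mx 1%:M 0 0 L), (col_mx 1%:M 0); split.
- rewrite !tr_block_mx !trmx0 !mulmx_diag_block LH trmx1 mul1mx mulmx1.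
  by rewrite mul_col_mx tr_col_mx trmx0 mul_col_row trmx1 mul1mx mulmx1 !mul0mx !mulmx0.
- by apply/row_free_row_mxl/row_free_block => //; rewrite row_free_unit unitmx1.
- by rewrite doubleD dm -addnn addnAC.
Qed.

(** The graph of [r] over the subspace [j] is isotropic for S _|_ (-Sd) and has half its dimension.
    For j = W^perp and r its projection to W^perp / W, this identifies the two Witt classes without
    splitting off a hyperbolic part. *)
Lemma sub_lagrangian_witt c n d (S : 'M[F]_n) (Sd : 'M_d)
    (j : 'M_(c, n)) (r : 'M_(c, d)) :
  row_free j -> (c.*2 = n + d)%N -> j *m S *m j^T = r *m Sd *m r^T -> witt S Sd.
Proof. by move=> fj e jr; exists c, j, r; split=> //; apply: row_free_row_mxl. Qed.

(* Symplectic-type reduction: j spans W^perp for the isotropic W = ker r, and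
   (U /\ W^perp) / W is again half-dimensional in W^perp / W. *)
Lemma lagrangian_reduction m c n d (S : 'M[F]_n) (Sd : 'M_d) (U : 'M_(m, n))
    (j : 'M_(c, n)) (r : 'M_(c, d)) :
  S \in unitmx -> Sd \in unitmx -> row_free U -> (m.*2 = n)%N ->
  U *m S *m U^T = 0 -> row_free j -> (c.*2 = n + d)%N ->
  j *m S *m j^T = r *m Sd *m r^T ->
  exists2 V : 'M_(c, d), ((\rank V).*2 = d)%N & V *m Sd *m V^T = 0.
Proof.
move=> uS uSd fU em iU fj ec jr.
set V0 := kermx (j *m cokermx U).
have V0U : (V0 *m j <= U)%MS by rewrite submxE -mulmxA mulmx_ker.
have iV : V0 *m r *m Sd *m (V0 *m r)^T = 0.
  have -> : V0 *m r *m Sd *m (V0 *m r)^T = (V0 *m j) *m S *m (V0 *m j)^T.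
    by rewrite !trmx_mul !mulmxA -!(mulmxA V0) -jr.
  have /submxP[D ->] := V0U.
  by rewrite trmx_mul -!mulmxA (mulmxA U) (mulmxA _ U^T) iU mul0mx mulmx0.
exists (V0 *m r) => //; apply/eqP; rewrite eqn_leq (isotropic_rank uSd iV) /=.
set Z := (V0 :&: kermx r)%MS.
have rkVr : (\rank (V0 *m r) + \rank Z)%N = \rank V0 by exact: mxrank_mul_ker.
have rV0 : (\rank V0 + \rank (j *m cokermx U))%N = c.
  by rewrite mxrank_ker subnK // rank_leq_row.
have rZ : \rank (S *m (Z *m j)^T) = \rank Z.
  rewrite -(mxrank_tr (S *m _)) trmx_mul trmxK !mxrankMfree //.
  by rewrite row_free_unit unitmx_tr.
(* [Z *m j] is the intersection of [U] with W. It is orthogonal to [j], because [r] kills it, and to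
   [U], which is isotropic; hence the rank of [j + U] is at most [n - \rank Z]. The rank of [Z] then
   cancels in the final count. *)
have perp : (j + U <= kermx (S *m (Z *m j)^T))%MS.
  rewrite addsmx_sub; apply/andP; split; apply/sub_kermxP.
    rewrite trmx_mul !mulmxA jr -!mulmxA -trmx_mul.
    have -> : Z *m r = 0 by apply/sub_kermxP; exact: capmxSr.
    by rewrite trmx0 !mulmx0.
  have /submxP[D ->] : (Z *m j <= U)%MS.
    by apply: submx_trans V0U; apply: submxMr; apply: capmxSl.
  by rewrite trmx_mul !mulmxA iU mul0mx.
have rjU : (\rank (j *m cokermx U) + m <= \rank (j + U)%MS)%N.
  rewrite -(mxrank_mul_ker (j + U)%MS (cokermx U)); apply: leq_add.
    by apply/mxrankS/submxMr/addsmxSl.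
  rewrite -{1}(eqP fU); apply: mxrankS; rewrite sub_capmx addsmxSr.
  by apply/sub_kermxP; rewrite mulmx_coker.
have := mxrankS perp; rewrite mxrank_ker rZ.
have : (\rank Z <= n)%N by rewrite -rZ rank_leq_row.
clear -em ec rkVr rV0 rjU; lia.
Qed.

Lemma unitmx_block n1 n2 (A : 'M[F]_n1) (B : 'M_n2) :
  A \in unitmx -> B \in unitmx -> block_mx A 0 0 B \in unitmx.
Proof. by rewrite -!row_free_unit; exact: row_free_block. Qed.

Lemma unitmxN n (A : 'M[F]_n) : A \in unitmx -> - A \in unitmx.
Proof. by rewrite -scaleN1r unitmxZ // unitrN1. Qed.

(** The two lagrangians add up to one of A _|_ (-B) _|_ B _|_ (-C). Take W to be the diagonal (0, b,
    b, 0): it is isotropic, W^perp consists of the vectors (a, b, b, c), and W^perp / W carries A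
    _|_ (-C), so [lagrangian_reduction] applies. *)
Lemma witt_trans n1 n2 n3 (A : 'M[F]_n1) (B : 'M_n2) (C : 'M_n3) :
  A \in unitmx -> B \in unitmx -> C \in unitmx ->
  witt A B -> witt B C -> witt A C.
Proof.
move=> uA uB uC [m1 [X [Y [e1 f1 d1]]]] [m2 [Y' [Z [e2 f2 d2]]]].
pose S := block_mx (block_mx A 0 0 (- B)) 0 0 (block_mx B 0 0 (- C)).
pose r : 'M[F]_(n1 + n3 + n2, n1 + n3) := lsubmx 1%:M.
pose a := lsubmx r; pose e := rsubmx r; pose b : 'M[F]_(n1 + n3 + n2, n2) := rsubmx 1%:M.
have er : r = row_mx a e by rewrite hsubmxK.
have [] := @lagrangian_reduction _ _ _ _ S (block_mx A 0 0 (- C))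
  (block_mx (row_mx X Y) 0 0 (row_mx Y' Z)) (row_mx (row_mx a b) (row_mx b e)) r.
- by rewrite /S !unitmx_block ?unitmxN.
- by rewrite !unitmx_block ?unitmxN.
- exact: row_free_block.
- by rewrite doubleD d1 d2.
- rewrite /S tr_block_mx !trmx0 !mulmx_diag_block !mul_row_diag_block.
  by rewrite e1 e2 !subrr block_mx0.
- apply: inj_row_free => v; rewrite !mul_mx_row => h.
  have [h1 h2] := eq_row_mx (etrans h (esym (row_mx0 _ _ _ _))).
  have [va vb] := eq_row_mx (etrans h1 (esym (row_mx0 _ _ _ _))).
  have [_ ve] := eq_row_mx (etrans h2 (esym (row_mx0 _ _ _ _))).
  rewrite -[v]mulmx1 -[1%:M]hsubmxK mul_mx_row -/b vb -/r er mul_mx_row va ve.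
  by rewrite !row_mx0.
- lia.
- rewrite /S (tr_row_mx (row_mx a b)) mul_row_block !mulmx0 addr0 add0r mul_row_col.
  by rewrite !mul_row_diag_block er mul_row_diag_block addrA subrK.
move=> V rV iV; apply/witt_wittE; exists <<V>>%MS; first by rewrite mxrank_gen.
have /submxP[D ->] : (<<V>> <= V)%MS by rewrite genmxE.
by rewrite trmx_mul -!mulmxA (mulmxA V) (mulmxA _ V^T) iV mul0mx mulmx0.
Qed.
End Witt.

(** * Invariant forms on semisimplifications *)

Section Forms.
Variables (F : fieldType) (G : Type).
Local Notation rep := (rep F G).

Definition inv_form (t : rep) (S : 'M[F]_(rdim t)) :=
  nondeg_sym S /\ invariant_form (@act F G t) S.

Definition dual (a : rep) : rep := Rep (fun g => (invmx (act a g))^T).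

Lemma inv_form_unit t (S : 'M_(rdim t)) g : inv_form S -> act t g \in unitmx.
Proof.
move=> [[_ uS] iS]; move: uS; rewrite -{1}(iS g) -mulmxA unitmx_mul.
by case/andP.
Qed.

Lemma sub_unit (a t : rep) (i : 'M_(rdim a, rdim t)) g :
  rhom i -> row_free i -> act t g \in unitmx -> act a g \in unitmx.
Proof.
move=> hi fi ut; rewrite -row_free_unit; apply: (@row_freeMl _ _ _ _ _ i).
by rewrite hi row_free_mul // row_free_unit.
Qed.

Lemma iso_form t s (S : 'M_(rdim s)) : iso t s -> inv_form S ->
  exists2 T : 'M_(rdim t), inv_form T & witt T S.
Proof.
move=> [X [hX fX gX]] [[sS uS] iS]; exists (X *m S *m X^T); last first.
  by apply/witt_sym/(witt_congr _ (erefl _)); rewrite (row_free_full_dim fX gX).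
split; first split.
- by rewrite !trmx_mul trmxK sS mulmxA.
- rewrite -row_free_unit row_free_mul //.
    by rewrite row_free_mul // row_free_unit.
  by rewrite /row_free mxrank_tr; apply: gX.
- move=> g; rewrite -[in RHS](iS g) !mulmxA hX -!mulmxA -!trmx_mul hX.
  by rewrite trmx_mul !mulmxA.
Qed.

Lemma inv_form_dsum (a b : rep) (A : 'M_(rdim a)) (B : 'M_(rdim b)) :
  inv_form A -> inv_form B -> @inv_form (dsum a b) (block_mx A 0 0 B).
Proof.
move=> [[sA uA] iA] [[sB uB] iB]; split; first split.
- by rewrite tr_block_mx !trmx0 sA sB.
- exact: unitmx_block.
- by move=> g; rewrite /= tr_block_mx !trmx0 !mulmx_diag_block iA iB.
Qed.

Definition hyp n : 'M[F]_(n + n) := block_mx 0 1%:M 1%:M 0.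

Lemma hyp_form a : (forall g, act a g \in unitmx) -> @inv_form (dsum a (dual a)) (hyp (rdim a)).
Proof.
move=> ua; split; first split.
- by rewrite tr_block_mx !trmx0 !trmx1.
- rewrite -row_free_unit; apply/row_freeP; exists (hyp _).
  by rewrite mulmx_block !(mulmx0, mul0mx, addr0, add0r, mulmx1) -scalar_mx_block.
- move=> g; rewrite /= tr_block_mx !trmx0 trmxK !mulmx_block.
  rewrite !(mulmx0, mul0mx, addr0, add0r, mulmx1) mulmxV // -trmx_mul mulmxV //.
  by rewrite trmx1.
Qed.

Lemma witt_hyp n m (A : 'M[F]_n) : witt (block_mx A 0 0 (hyp m)) A.
Proof.
apply: (@witt_metabolic _ m _ _ _ _ (row_mx 1%:M 0)); last first.
- by rewrite mul_row_block !(mulmx0, mul0mx, addr0, add0r, mulmx1) tr_row_mx mul_row_col trmx1 trmx0 mulmx0 mul0mx addr0.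
- by rewrite addnn.
- by apply: row_free_row_mxl; rewrite row_free_unit unitmx1.
Qed.

(** The annihilator [kermx U^T] of a submodule [U] of the dual is a submodule of [a]. As [G] has no
    inverses here, stability of [U] under the transposed action is first recovered from stability
    under its inverse by comparing ranks. *)
Lemma irr_dual a : (forall g, act a g \in unitmx) -> irr a -> irr (dual a).
Proof.
move=> ua ia U sU.
have sU' g : (U *m (act a g)^T <= U)%MS.
  have uT : (invmx (act a g))^T \in unitmx by rewrite unitmx_tr unitmx_inv.
  have /submxP[D eD] : (U <= U *m (invmx (act a g))^T)%MS.
    rewrite -(geq_leqif (mxrank_leqif_sup (sU g))) /=.
    by rewrite mxrankMfree // row_free_unit.
  apply/submxP; exists D; rewrite {1}eD -!mulmxA -trmx_mul mulmxV //.
  by rewrite trmx1 mulmx1.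
have [g|k0|kf] := ia (kermx U^T).
- apply/sub_kermxP; have /submxP[D eD] := sU' g.
  have -> : kermx U^T *m act a g *m U^T = kermx U^T *m (U *m (act a g)^T)^T.
    by rewrite trmx_mul trmxK mulmxA.
  by rewrite eD trmx_mul mulmxA mulmx_ker mul0mx.
- right; rewrite /row_full -mxrank_tr; change (row_free U^T).
  by rewrite -kermx_eq0 k0.
left; apply: trmx_inj; rewrite trmx0; apply: (row_full_inj kf).
by rewrite mulmx_ker mulmx0.
Qed.

(** The simple submodule is the first nonzero leaf of the derivation of [ssz t s]. *)
Lemma irr_sub t s : ssz t s -> (0 < rdim t)%N ->
  exists (w : rep) (i : 'M_(rdim w, rdim t)),
    [/\ irr w, rhom i, row_free i & (0 < rdim w)%N].
Proof.
elim=> {t s} [t s it _ t0|a t b s1 s2 s E _ IA _ IB _ t0].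
  exists t, 1%:M; split=> //; first exact: rhom1.
  by rewrite row_free_unit unitmx1.
have [a0|a0] := posnP (rdim a).
  have [X [hX fX gX]] := iso_sym (exact0l E a0).
  have b0 : (0 < rdim b)%N by rewrite (row_free_full_dim fX gX).
  have [w [i [iw hi fi w0]]] := IB b0.
  by exists w, (i *m X); split; rewrite ?row_free_mul //; apply: rhomM.
have [w [i [iw hi fi w0]]] := IA a0.
have [j [p [[hj _] fj _ _ _]]] := E.
by exists w, (i *m j); split; rewrite ?row_free_mul //; apply: rhomM.
Qed.

(** This is the map x |-> S(x, -) restricted to the submodule [a]; its kernel is the orthogonal of
    [a]. *)
Lemma pairing_hom (t a : rep) (S : 'M_(rdim t)) (i : 'M_(rdim a, rdim t)) :
  inv_form S -> rhom i -> row_free i -> @rhom F G t (dual a) (S *m i^T).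
Proof.
move=> fS hi fi g; have ua := sub_unit hi fi (inv_form_unit g fS).
apply: trmx_inj; rewrite !trmx_mul !trmxK.
have [[sS _] iS] := fS; rewrite sS.
apply: (row_full_inj (A := act a g)); first by rewrite row_full_unit.
by rewrite !mulmxA mulmxV // mul1mx hi -!mulmxA (mulmxA (act t g)) iS.
Qed.

Lemma restrict_form_inv (c t : rep) (S : 'M_(rdim t)) (j : 'M_(rdim c, rdim t)) :
  rhom j -> invariant_form (@act F G t) S ->
  invariant_form (@act F G c) (j *m S *m j^T).
Proof.
move=> hj iS g; rewrite -[in RHS](iS g) !mulmxA hj -!mulmxA -!trmx_mul hj.
by rewrite trmx_mul !mulmxA.
Qed.

Lemma dsumA (a b c : rep) : iso (dsum (dsum a b) c) (dsum a (dsum b c)).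
Proof.
pose A : 'M[F]_(rdim a, rdim a + (rdim b + rdim c)) := row_mx 1%:M 0.
pose B : 'M[F]_(rdim b, rdim a + (rdim b + rdim c)) := row_mx 0 (row_mx 1%:M 0).
pose C : 'M[F]_(rdim c, rdim a + (rdim b + rdim c)) := row_mx 0 (row_mx 0 1%:M).
apply: (@isoP F G (dsum (dsum a b) c) (dsum a (dsum b c)) (col_mx (col_mx A B) C)).
- apply: (col_mx_rhom (a := dsum a b)); first apply: col_mx_rhom; move=> g /=;
  rewrite /A /B /C ?mul_row_block ?mul_mx_row ?mul_row_block ?mul_mx_row;
  by rewrite !(mulmx0, mul0mx, mulmx1, mul1mx, addr0, add0r, row_mx0).
- apply/row_freeP; exists (row_mx (row_mx A^T B^T) C^T).
  rewrite /A /B /C !tr_row_mx !mul_col_row !mul_col_mx !mul_mx_row !mul_row_col.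
  rewrite !trmx0 !trmx1 !(mulmx0, mul0mx, mulmx1, mul1mx, addr0, add0r, row_mx0).
  by rewrite col_mx0 -!scalar_mx_block.
- by rewrite /= addnA.
Qed.

(** The semisimplification [s] is prescribed, so each reduction must also cut [s]: [ssz_exact]
    splits it along the same exact sequences as [t], and the pieces are reassembled up to
    isomorphism. [N] bounds the dimension for the induction. *)
Lemma semisimple_form N t s (S : 'M_(rdim t)) :
  (rdim t <= N)%N -> ssz t s -> inv_form S ->
  exists2 T : 'M_(rdim s), inv_form T & witt T S.
Proof.
elim: N t s S => [|N IHN] t s S tN ts fS.
  have it : irr t by apply: irr0; apply/eqP; rewrite -leqn0.
  exact: iso_form (iso_sym (ssz_irr_iso ts it)) fS.
have [t0|t0] := posnP (rdim t).
  exact: iso_form (iso_sym (ssz_irr_iso ts (irr0 t0))) fS.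
have [w [i [iw hi fi w0]]] := irr_sub ts t0.
have ut g := inv_form_unit g fS.
have uw g := sub_unit hi fi (ut g).
have hp := pairing_hom fS hi fi.
have [[sS uS] iS] := fS.
have gp : row_full (S *m i^T).
  by rewrite -[i]trmxK; rewrite /row_full -mxrank_tr trmx_mul !trmxK mxrankMfree ?row_free_unit ?unitmx_tr // fi.
have [c [j [hj fj jp kj ec]]] := ker_rep hp.
rewrite (eqP gp) in ec.
(* Here [c] is W^perp. The sequence serves both cases, since the factor complementary to W^perp is
   always the dual of W. *)
have Ec : short_exact c t (dual w) by exists j, (S *m i^T).
have [s1 [s2 [S1 S2 is12]]] := ssz_exact ts Ec.
have i2 := ssz_irr_iso S2 (irr_dual uw iw).
have cN : (rdim c <= N)%N by move: ec tN w0; rewrite /=; clear; lia.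
pose H := i *m S *m i^T.
have hH : @rhom F G w (dual w) H by rewrite /H -mulmxA; apply: rhomM.
have sH : H^T = H by rewrite /H !trmx_mul trmxK sS mulmxA.
have iH : invariant_form (act w) H.
  move=> g; rewrite hH /= -mulmxA -trmx_mul mulmxV // trmx1 mulmx1 //.
(* The Gram matrix [H] of W is equivariant from [w] to its dual, so its kernel is a submodule of the
   simple [w]: W is nondegenerate or totally isotropic. *)
have [g|kH|kH] := iw (kermx H); first exact: (@ker_stable F G w (dual w)).
- have uH : H \in unitmx by rewrite -row_free_unit -kermx_eq0 kH.
  have perp : j *m S *m i^T = 0 by rewrite -mulmxA.
  have perp' : i *m S *m j^T = 0.
    by apply: trmx_inj; rewrite !trmx_mul trmxK sS trmx0 mulmxA.
  have gram : col_mx j i *m S *m (col_mx j i)^T = block_mx (j *m S *m j^T) 0 0 H.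
    by rewrite tr_col_mx mul_col_mx mul_col_row perp perp'.
  have fji : row_free (col_mx j i).
    apply: inj_row_free => v; rewrite -[v]hsubmxK mul_row_col => v0.
    have v2 : rsubmx v = 0.
      apply: (row_free_inj (A := H)); first by rewrite row_free_unit.
      rewrite mul0mx; move/(congr1 (fun M => M *m S *m i^T)): v0.
      by rewrite !mulmxDl !mul0mx -!mulmxA (mulmxA j) perp mulmx0 add0r !mulmxA.
    move: v0; rewrite v2 mul0mx addr0 => v1.
    by rewrite (row_free_inj fj (etrans v1 (esym (mul0mx _ _)))) row_mx0.
  have gji : row_full (col_mx j i) by apply: row_free_dim_full.
  have uB : block_mx (j *m S *m j^T) 0 0 H \in unitmx.
    rewrite -gram -row_free_unit !row_free_mul ?row_free_unit //.
    by rewrite /row_free mxrank_tr; apply: gji.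
  have fc : inv_form (j *m S *m j^T).
    split; first split.
    - by rewrite !trmx_mul trmxK sS mulmxA.
    - rewrite -row_free_unit; apply: inj_row_free => v v0.
      have : row_mx v (0 : 'M_(1, rdim w)) = 0.
        apply: (row_free_inj (A := block_mx (j *m S *m j^T) 0 0 H)).
          by rewrite row_free_unit.
        by rewrite mul_row_block v0 !mulmx0 !mul0mx !addr0 row_mx0.
      by move=> e; have [] := eq_row_mx (etrans e (esym (row_mx0 _ _ _ _))).
    - exact: restrict_form_inv.
  have fH : inv_form H by [].
  have [T1 fT1 wT1] := IHN _ _ _ cN S1 fc.
  have ws2 : iso s2 w.
    apply: iso_sym; apply: iso_trans i2; exists H.
    by rewrite row_free_unit row_full_unit uH.
  have [T2 fT2 wT2] := iso_form ws2 fH.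
  have [T fT wT] := iso_form (iso_sym is12) (inv_form_dsum fT1 fT2).
  exists T => //.
  have [[[_ uT] _] [[_ uT1] _] [[_ uT2] _]] := And3 fT fT1 fT2.
  have [[_ uM] _] := fc.
  apply: witt_trans wT _; rewrite ?unitmx_block //.
  apply: witt_trans (witt_block wT1 wT2) _; rewrite ?unitmx_block //.
  apply: witt_sym; exact: (witt_congr (esym ec) gram).
have H0 : H = 0 by apply: (row_full_inj kH); rewrite mulmx_ker mulmx0.
have /submxP[l el] : (i <= j)%MS.
  by apply: submx_trans kj; apply/sub_kermxP; rewrite mulmxA.
have fl : row_free l by apply: (@row_freeMl _ _ _ _ _ j); rewrite -el.
have hl : @rhom F G w c l by apply: rhom_cancel_free fj hj _; rewrite -el.
have [d [r [hr fr lr kr ed]]] := coker_rep hl.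
rewrite (eqP fl) in ed.
have Ed : short_exact w c d by exists l, r.
have [s3 [s4 [S3 S4 is34]]] := ssz_exact S1 Ed.
have i3 := ssz_irr_iso S3 iw.
(* The form on W^perp / W is pulled back along a merely linear section [q] of [r]. The choice is
   harmless because W lies in the radical of the form on W^perp. *)
have /row_fullP[q qr] := fr.
pose Sd := q *m (j *m S *m j^T) *m q^T.
have jSl : j *m S *m j^T *m l^T = 0.
  by rewrite -mulmxA -trmx_mul -el -mulmxA.
have eSd : j *m S *m j^T = r *m Sd *m r^T.
  have /submxP[D eD] : (1%:M - r *m q <= l)%MS.
    apply: submx_trans kr; apply/sub_kermxP.
    by rewrite mulmxBl mul1mx -mulmxA qr mulmx1 subrr.
  have e1 : r *m q = 1%:M - D *m l by rewrite -eD opprB addrCA subrr addr0.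
  have lSj : l *m (j *m S *m j^T) = 0.
    by apply: trmx_inj; rewrite trmx_mul !trmx_mul trmxK sS trmx0 -jSl !mulmxA.
  have rqM : r *m q *m (j *m S *m j^T) = j *m S *m j^T.
    by rewrite e1 mulmxBl mul1mx -(mulmxA D) lSj mulmx0 subr0.
  have Mrq : j *m S *m j^T *m (r *m q)^T = j *m S *m j^T.
    have symM : (j *m S *m j^T)^T = j *m S *m j^T by rewrite !trmx_mul trmxK sS mulmxA.
    by rewrite -{1}symM -trmx_mul rqM.
  have -> : r *m Sd *m r^T = r *m q *m (j *m S *m j^T) *m (r *m q)^T.
    by rewrite /Sd trmx_mul !mulmxA.
  by rewrite rqM Mrq.
have sSd : Sd^T = Sd by rewrite /Sd !trmx_mul !trmxK sS !mulmxA.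
clearbody Sd.
have fd : inv_form Sd.
  split; first split.
  - exact: sSd.
  - rewrite -row_free_unit; apply: inj_row_free => v v0.
    (* A radical vector of W^perp / W lifts to a vector orthogonal to W^perp, hence in W: the double
       orthogonal of W is W by dimension. *)
    have ker_i : (kermx (S *m j^T) <= i)%MS.
      apply: (@exact_ker F G w t (dual c) i (S *m j^T)) => //.
      + by rewrite /row_full -mxrank_tr trmx_mul trmxK sS mxrankMfree ?row_free_unit.
      + by apply: trmx_inj; rewrite !trmx_mul trmxK sS -mulmxA jp trmx0.
      + by rewrite -ec addnC.
    have /submxP[y ey] : (v *m q *m j <= i)%MS.
      apply: submx_trans ker_i; apply/sub_kermxP.
      rewrite -!mulmxA (mulmxA j) eSd !mulmxA -(mulmxA v) qr mulmx1 v0.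
      by rewrite mul0mx.
    have vq : v *m q = y *m l by apply: (row_free_inj fj); rewrite ey el mulmxA.
    by rewrite -[v]mulmx1 -qr mulmxA vq -mulmxA lr mulmx0.
  - move=> g; have := restrict_form_inv hj iS g; rewrite eSd.
    rewrite !mulmxA hr -!mulmxA -!trmx_mul hr trmx_mul => e.
    apply: (row_full_inj fr); apply: (row_free_inj (A := r^T)).
      by rewrite /row_free mxrank_tr; apply: fr.
    by rewrite -!mulmxA.
have dN : (rdim d <= N)%N by move: ed cN; clear; lia.
have [T4 fT4 wT4] := IHN _ _ _ dN S4 fd.
have iss : iso s (dsum s4 (dsum w (dual w))).
  apply: iso_trans (iso_sym is12) _.
  apply: iso_trans (iso_dsum (iso_sym is34) (iso_sym i2)) _.
  apply: iso_trans (iso_dsum (dsumC _ _) (iso_refl _)) _.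
  apply: iso_trans (dsumA _ _ _) _.
  exact: iso_dsum (iso_refl _) (iso_dsum (iso_sym i3) (iso_refl _)).
have [T fT wT] := iso_form iss (inv_form_dsum fT4 (hyp_form uw)).
exists T => //.
have [[[_ uT] _] [[_ uT4] _] [[_ uh] _]] := And3 fT fT4 (hyp_form uw).
have [[_ uSd] _] := fd.
apply: witt_trans wT _; rewrite ?unitmx_block //.
apply: witt_trans (witt_hyp _ _) _; rewrite ?unitmx_block //.
apply: witt_trans wT4 _; rewrite //.
apply/witt_sym/(sub_lagrangian_witt fj _ eSd).
by move: ec ed => /=; clear; lia.
Qed.

End Forms.

(** * Integral matrices over a discrete valuation ring *)

Section Valuation.
Variables (K k : fieldType) (v : K -> int) (pi : K) (red : K -> k).
Hypothesis Hv : discrete_valuation v pi.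
Hypothesis Hr : residue_map v red.
Local Notation R := (in_R v).
Local Notation integral := (integral_mx v).

Lemma pi_neq0 : pi != 0. Proof. by case: Hv. Qed.

Lemma vM x y : x != 0 -> y != 0 -> v (x * y) = v x + v y.
Proof. by case: Hv => _ _ + _; apply. Qed.

Lemma v1 : v 1 = 0.
Proof.
have := vM (oner_neq0 K) (oner_neq0 K); rewrite mulr1 => e.
by apply: (addrI (v 1)); rewrite -e addr0.
Qed.

Lemma vN x : x != 0 -> v (- x) = v x.
Proof.
move=> x0; have n1 : (-1 : K) != 0 by rewrite oppr_eq0 oner_neq0.
have vn1 : v (-1) = 0.
  by have := vM n1 n1; rewrite mulrNN mulr1 v1; lia.
by rewrite -mulN1r vM // vn1 add0r.
Qed.

Lemma vV x : x != 0 -> v x^-1 = - v x.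
Proof.
move=> x0; have := vM x0 (invr_neq0 x0); rewrite divff // v1; lia.
Qed.

Lemma piX_neq0 (z : int) : pi ^ z != 0.
Proof. by rewrite expfz_neq0 // pi_neq0. Qed.

Lemma v_piX (z : int) : v (pi ^ z) = z.
Proof.
have vpi : v pi = 1 by case: Hv.
have pos (n : nat) : v (pi ^+ n) = n%:Z.
  elim: n => [|n IHn]; first by rewrite expr0 v1.
  by rewrite exprS vM ?expf_neq0 ?pi_neq0 // IHn vpi; lia.
case: z => n; first exact: pos.
by rewrite NegzE -exprnN vV ?expf_neq0 ?pi_neq0 // pos.
Qed.

Lemma inRE x : x != 0 -> R x = (0 <= v x).
Proof. by rewrite /in_R => /negPf ->. Qed.

Lemma inR0 : R 0. Proof. by rewrite /in_R eqxx. Qed.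

Lemma inR1 : R 1. Proof. by rewrite /in_R v1 lexx orbT. Qed.

Lemma inRN x : R x -> R (- x).
Proof.
by have [->|x0] := eqVneq x 0; rewrite ?oppr0 // !inRE ?oppr_eq0 // vN.
Qed.

Lemma inRM x y : R x -> R y -> R (x * y).
Proof.
have [->|x0] := eqVneq x 0; first by rewrite mul0r.
have [->|y0] := eqVneq y 0; first by rewrite mulr0.
by rewrite !inRE ?mulf_neq0 // vM //; apply: addr_ge0.
Qed.

Lemma inRD x y : R x -> R y -> R (x + y).
Proof.
have [->|x0] := eqVneq x 0; first by rewrite add0r.
have [->|y0] := eqVneq y 0; first by rewrite addr0.
have [->|xy0] := eqVneq (x + y) 0; first by rewrite inR0.
rewrite !inRE // => vx vy.
by have [_ _ _ /(_ x y x0 y0 xy0)/orP[]] := Hv; apply: le_trans.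
Qed.

Lemma inR_sum (I : Type) (r : seq I) (P : pred I) (f : I -> K) :
  (forall i, P i -> R (f i)) -> R (\sum_(i <- r | P i) f i).
Proof. by move=> Rf; elim/big_ind: _ => //; [exact: inR0 | exact: inRD]. Qed.

Lemma inR_nat b : R (b%:R).
Proof. by elim: b => [|b IHb]; rewrite ?inR0 // -addn1 natrD inRD // inR1. Qed.

Lemma red1 : red 1 = 1. Proof. by case: Hr. Qed.

Lemma redD x y : R x -> R y -> red (x + y) = red x + red y.
Proof. by case: Hr => _ + _ _ _; apply. Qed.

Lemma redM x y : R x -> R y -> red (x * y) = red x * red y.
Proof. by case: Hr => _ _ + _ _; apply. Qed.

Lemma red0 : red 0 = 0.
Proof.
by apply: (addrI (red 0)); rewrite -redD ?inR0 // !addr0.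
Qed.

Lemma redN x : R x -> red (- x) = - red x.
Proof.
move=> Rx; apply: (addrI (red x)).
by rewrite -redD ?inRN // !subrr red0.
Qed.

Lemma red_sum (I : Type) (r : seq I) (f : I -> K) :
  (forall i, R (f i)) -> red (\sum_(i <- r) f i) = \sum_(i <- r) red (f i).
Proof.
move=> Rf; elim: r => [|i r IHr]; first by rewrite !big_nil red0.
by rewrite !big_cons redD ?IHr //; apply: inR_sum.
Qed.

Lemma red_nat b : red b%:R = b%:R.
Proof.
elim: b => [|b IHb]; first exact: red0.
by rewrite -addn1 !natrD redD ?inR_nat ?inR1 // IHb red1.
Qed.

Lemma red_eq0 x : R x -> (red x == 0) = (x == 0) || (1 <= v x).
Proof. by case: Hr => _ _ _ _; apply. Qed.

Lemma red_piM x : R x -> red (pi * x) = 0.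
Proof.
have vpi : v pi = 1 by case: Hv.
have Rpi : R pi by rewrite inRE ?pi_neq0 // vpi.
move=> Rx; rewrite redM //.
have /eqP -> : red pi == 0 by rewrite red_eq0 // vpi lexx orbT.
by rewrite mul0r.
Qed.

Lemma red_neq0 x : R x -> red x != 0 -> x != 0 /\ v x = 0.
Proof.
move=> Rx; rewrite red_eq0 // negb_or => /andP[x0]; split=> //.
by move: Rx; rewrite inRE //; lia.
Qed.

Lemma inR_inv x : R x -> red x != 0 -> R x^-1.
Proof.
move=> Rx /(red_neq0 Rx)[x0 vx].
by rewrite inRE ?invr_eq0 // vV // vx oppr0.
Qed.

Lemma unit_part_neq0 x : x != 0 -> unit_part v pi x != 0.
Proof. by move=> x0; rewrite mulf_neq0 ?invr_eq0 ?piX_neq0. Qed.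

Lemma v_unit_part x : x != 0 -> v (unit_part v pi x) = 0.
Proof.
move=> x0; rewrite vM ?invr_eq0 ?piX_neq0 // vV ?piX_neq0 // v_piX.
by rewrite subrr.
Qed.

Lemma unit_partE x : x = unit_part v pi x * pi ^ v x.
Proof. by rewrite /unit_part divfK ?piX_neq0. Qed.

Lemma inR_unit_part x : R (unit_part v pi x).
Proof.
have [->|x0] := eqVneq x 0; first by rewrite /unit_part mul0r inR0.
by rewrite inRE ?unit_part_neq0 // v_unit_part.
Qed.

Lemma red_unit_part x : x != 0 -> red (unit_part v pi x) != 0.
Proof.
move=> x0; rewrite red_eq0 ?inR_unit_part // (negPf (unit_part_neq0 x0)).
by rewrite v_unit_part.
Qed.

Lemma integral1 n : integral (1%:M : 'M[K]_n).
Proof. by move=> i j; rewrite mxE; apply: inR_nat. Qed.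

Lemma integral0 m n : integral (0 : 'M[K]_(m, n)).
Proof. by move=> i j; rewrite mxE; apply: inR0. Qed.

Lemma integralM m n p (A : 'M[K]_(m, n)) (B : 'M_(n, p)) :
  integral A -> integral B -> integral (A *m B).
Proof. by move=> RA RB i j; rewrite mxE; apply: inR_sum => l _; apply: inRM. Qed.

Lemma integralD m n (A B : 'M[K]_(m, n)) :
  integral A -> integral B -> integral (A + B).
Proof. by move=> RA RB i j; rewrite mxE; apply: inRD. Qed.

Lemma integralN m n (A : 'M[K]_(m, n)) : integral A -> integral (- A).
Proof. by move=> RA i j; rewrite mxE; apply: inRN. Qed.

Lemma integral_tr m n (A : 'M[K]_(m, n)) : integral A -> integral A^T.
Proof. by move=> RA i j; rewrite mxE. Qed.

Lemma integral_block m1 m2 n1 n2 (A : 'M[K]_(m1, n1)) B C (D : 'M_(m2, n2)) :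
  integral A -> integral B -> integral C -> integral D -> integral (block_mx A B C D).
Proof.
move=> RA RB RC RD i j; rewrite -[i]splitK -[j]splitK.
by case: split => a; case: split => b /=;
  rewrite ?block_mxEul ?block_mxEur ?block_mxEdl ?block_mxEdr.
Qed.

Lemma red_mulmx m n p (A : 'M[K]_(m, n)) (B : 'M_(n, p)) :
  integral A -> integral B ->
  map_mx red (A *m B) = map_mx red A *m map_mx red B.
Proof.
move=> RA RB; apply/matrixP => i j; rewrite !mxE red_sum => [|l]; last exact: inRM.
by apply: eq_bigr => l _; rewrite !mxE redM.
Qed.

Lemma red_mx1 n : map_mx red (1%:M : 'M[K]_n) = 1%:M.
Proof. by apply/matrixP => i j; rewrite !mxE red_nat. Qed.

(* C ranges over GL_n(R), with C' its inverse *)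
Definition unimodular n (C C' : 'M[K]_n) :=
  [/\ integral C, integral C' & C *m C' = 1%:M].

Lemma unimodularM n (A A' B B' : 'M[K]_n) :
  unimodular A A' -> unimodular B B' -> unimodular (A *m B) (B' *m A').
Proof.
move=> [RA RA' AA] [RB RB' BB]; split; try exact: integralM.
by rewrite mulmxA -(mulmxA A) BB mulmx1.
Qed.

Lemma unimodular1 n : unimodular (1%:M : 'M[K]_n) 1%:M.
Proof. by split; rewrite ?mul1mx //; apply: integral1. Qed.

Lemma unimodular_tperm n (i j : 'I_n) : unimodular (tperm_mx i j) (tperm_mx i j).
Proof.
by split; [move=> a b; rewrite !mxE; apply: inR_nat
          |move=> a b; rewrite !mxE; apply: inR_nat
          |rewrite -perm_mxM tperm2 perm_mx1].
Qed.

Lemma delta_mulE m n p (A : 'M[K]_(n, p)) (i a : 'I_m) (j : 'I_n) b :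
  (delta_mx i j *m A) a b = (a == i)%:R * A j b.
Proof.
rewrite mxE (bigD1 j) //= big1 ?addr0 => [|l ne]; rewrite mxE ?eqxx ?andbT //.
by rewrite (negPf ne) andbF mul0r.
Qed.

Lemma mul_deltaE m n p (A : 'M[K]_(p, m)) (i : 'I_m) (j b : 'I_n) a :
  (A *m delta_mx i j) a b = A a i * (b == j)%:R.
Proof.
rewrite mxE (bigD1 i) //= big1 ?addr0 => [|l ne]; rewrite mxE ?eqxx //.
by rewrite (negPf ne) mulr0.
Qed.

Lemma unimodular_transv n (i j : 'I_n) : i != j ->
  unimodular (1%:M + delta_mx i j) (1%:M - delta_mx i j).
Proof.
move=> ij; have Rd : integral (delta_mx i j : 'M[K]_n).
  by move=> a b; rewrite mxE; apply: inR_nat.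
split; first by apply: integralD; [exact: integral1|].
  by apply: integralD; [exact: integral1|exact: integralN].
rewrite mulmxBr mulmx1 mulmxDl mul1mx mul_delta_mx_cond eq_sym (negPf ij) mulr0n.
by rewrite addr0 addrK.
Qed.

(** If neither [S i i] nor [S j j] is a unit, then e_i + e_j has norm congruent to 2 mod pi, a unit
    since the residue characteristic is not 2. A transposition then moves the unit to the corner. *)
Lemma residual_pivot n (S : 'M[K]_n.+1) i j : (2%:R : k) != 0 ->
  S^T = S -> integral S -> S i j = 1 ->
  exists C C', unimodular C C' /\ red ((C *m S *m C^T) 0 0) != 0.
Proof.
move=> two sS RS Sij.
have symE a b : S a b = S b a by rewrite -{1}sS mxE.
have diag (M : 'M[K]_n.+1) a : (tperm_mx 0 a *m M *m (tperm_mx 0 a)^T) 0 0 = M a a.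
  rewrite tr_tperm_mx -row_permE -[X in _ *m perm_mx X]tpermV -col_permE !mxE.
  by rewrite tpermL.
have [ii|] := boolP (red (S i i) == 0); last first.
  move=> ii; exists (tperm_mx 0 i), (tperm_mx 0 i); rewrite diag.
  by split=> //; apply: unimodular_tperm.
have [jj|] := boolP (red (S j j) == 0); last first.
  move=> jj; exists (tperm_mx 0 j), (tperm_mx 0 j); rewrite diag.
  by split=> //; apply: unimodular_tperm.
have ij : i != j.
  by apply/eqP => e; move: Sij ii; rewrite -e => ->; rewrite red1 oner_eq0.
exists (tperm_mx 0 i *m (1%:M + delta_mx i j)), ((1%:M - delta_mx i j) *m tperm_mx 0 i).
split.
  by apply: unimodularM; [exact: unimodular_tperm|exact: unimodular_transv].
rewrite trmx_mul !mulmxA -2!(mulmxA (tperm_mx 0 i)) diag.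
have addE (A B : 'M[K]_n.+1) a b : (A + B) a b = A a b + B a b by rewrite mxE.
rewrite raddfD /= trmx1 trmx_delta mulmxDr mulmx1 mulmxDl mul1mx addE mul_deltaE.
rewrite !addE !delta_mulE eqxx mulr1 !mul1r (symE j i) Sij.
rewrite !redD ?inRD ?inR1 // red1 (eqP ii) (eqP jj) add0r addr0.
by rewrite -[1 + 1]/(2%:R).
Qed.

Lemma ulsubmx11 n (A : 'M[K]_(1 + n)) : ulsubmx A = (A 0 0)%:M.
Proof.
by rewrite [LHS]mx11_scalar !mxE; congr (A _ _)%:M; apply: val_inj.
Qed.

Lemma integral_ursub n (A : 'M[K]_(1 + n)) : integral A -> integral (ursubmx A).
Proof. by move=> RA i j; rewrite !mxE. Qed.

(** Gram-Schmidt over R: once the corner is a unit [p], the elimination matrix [E] has integral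
    entries, and the induction continues with the Schur complement. *)
Lemma unimodular_diag n (S : 'M[K]_n) : (2%:R : k) != 0 -> S^T = S ->
  exists C C' d, unimodular C C' /\ C *m S *m C^T = diag_mx d.
Proof.
move=> two; elim: n S => [|n IHn] S sS.
  by exists 1%:M, 1%:M, 0; split; [exact: unimodular1|apply/matrixP => -[]].
have [S0|S0] := eqVneq S 0.
  exists 1%:M, 1%:M, 0; split; first exact: unimodular1.
  by rewrite S0 mulmx0 mul0mx; apply/matrixP => i j; rewrite !mxE mul0rn.
have [[i0 j0] /= Sij0] : exists p : 'I_n.+1 * 'I_n.+1, S p.1 p.2 != 0.
  apply/existsP; apply: contraNT S0 => /existsPn z.
  by apply/eqP/matrixP => i j; rewrite mxE; apply/eqP; have := z (i, j); rewrite negbK.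
(* Dividing by an entry of least valuation makes the matrix integral with an entry equal to 1, so
   [S] itself may have denominators. *)
case: (@arg_minP _ _ _ (i0, j0) (fun p => S p.1 p.2 != 0) (fun p => v (S p.1 p.2))) => //.
move=> [i j] /= Sij minS; set s := S i j in Sij minS.
have RS : integral (s^-1 *: S).
  move=> a b; rewrite mxE; have [->|Sab] := eqVneq (S a b) 0.
    by rewrite mulr0 inR0.
  rewrite inRE ?mulf_neq0 ?invr_eq0 // vM ?invr_eq0 // vV // addrC subr_ge0.
  exact: (minS (a, b)).
have [|||C [C' [UC rC]]] := @residual_pivot n (s^-1 *: S) i j two.
- by rewrite linearZ /= sS.
- exact: RS.
- by rewrite mxE mulVf.
pose S1 : 'M[K]_(1 + n) := C *m (s^-1 *: S) *m C^T.
have [RC RC' CC] := UC.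
have RS1 : integral S1.
  by apply: integralM; [apply: integralM|apply: integral_tr].
have sS1 : S1^T = S1.
  by rewrite /S1 !trmx_mul trmxK linearZ /= sS mulmxA.
have S100 : ulsubmx S1 = (S1 0 0)%:M.
  exact: ulsubmx11.
have s1 : S1 0 0 != 0 by have [] := red_neq0 (RS1 0 0) rC.
set p := S1 0 0 in S100 s1.
set t := ursubmx S1; set S2 := drsubmx S1.
have eS1 : S1 = block_mx p%:M t t^T S2.
  rewrite -[LHS]submxK S100 -/t -/S2; congr block_mx.
  by rewrite /t -{2}sS1 trmx_ursub trmxK.
have sS2 : S2^T = S2 by rewrite /S2 trmx_drsub sS1.
have Rt : integral t by exact: integral_ursub.
have Rpt : integral (- (p^-1 *: t^T)).
  apply: integralN => a b; rewrite mxE; apply: inRM; last exact: integral_tr.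
  exact: inR_inv (RS1 0 0) rC.
have sS3 : (S2 - p^-1 *: (t^T *m t))^T = S2 - p^-1 *: (t^T *m t).
  by rewrite linearB /= sS2 linearZ /= trmx_mul trmxK.
have [C2 [C2' [d2 [UC2 eC2]]]] := IHn _ sS3.
pose E : 'M[K]_(1 + n) := block_mx 1%:M 0 (- (p^-1 *: t^T)) 1%:M.
pose E' : 'M[K]_(1 + n) := block_mx 1%:M 0 (p^-1 *: t^T) 1%:M.
have UE : unimodular E E'.
  split.
  - by apply: integral_block => //; [exact: integral1|exact: integral0|exact: integral1].
  - apply: integral_block; [exact: integral1|exact: integral0| |exact: integral1].
    by rewrite -[p^-1 *: _]opprK; exact: integralN.
  rewrite mulmx_block !(mulmx0, mul0mx, mulmx1, mul1mx, addr0, add0r).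
  by rewrite addNr -scalar_mx_block.
have eE : E *m S1 *m E^T = block_mx p%:M 0 0 (S2 - p^-1 *: (t^T *m t)).
  rewrite eS1 /E tr_block_mx !mulmx_block !trmx0 !trmx1.
  rewrite !(mulmx0, mul0mx, mulmx1, mul1mx, addr0, add0r) linearN linearZ /= trmxK.
  have -> : - (p^-1 *: t^T) *m p%:M + t^T = 0.
    by rewrite mul_mx_scalar scalerN scalerA mulfV // scale1r addNr.
  rewrite mul0mx add0r; congr block_mx.
    by rewrite mul_scalar_mx scalerN scalerA mulfV // scale1r addNr.
  by rewrite mulNmx -scalemxAl addrC.
have [RC2 RC2' CC2] := UC2.
pose B : 'M[K]_(1 + n) := block_mx 1%:M 0 0 C2.
pose B' : 'M[K]_(1 + n) := block_mx 1%:M 0 0 C2'.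
have UB : unimodular B B'.
  split; try by apply: integral_block => //; [exact: integral1|exact: integral0|exact: integral0].
  rewrite mulmx_block !(mulmx0, mul0mx, mulmx1, mul1mx, addr0, add0r) CC2.
  by rewrite -scalar_mx_block.
exists (B *m E *m C), (C' *m (E' *m B')), (s *: row_mx p%:M d2); split.
  apply: unimodularM UC; exact: unimodularM.
have -> : diag_mx (s *: row_mx p%:M d2) = s *: block_mx p%:M 0 0 (diag_mx d2).
  rewrite linearZ /= diag_mx_row; congr (_ *: block_mx _ _ _ _).
  by apply/matrixP => a b; rewrite !ord1 !mxE eqxx.
have -> : B *m E *m C *m S *m (B *m E *m C)^T = s *: (B *m (E *m S1 *m E^T) *m B^T).
  rewrite /S1 -!(scalemxAl, scalemxAr) scalerA mulfV // scale1r.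
  by rewrite !trmx_mul !mulmxA.
rewrite eE /B tr_block_mx !mulmx_block !trmx0 !trmx1.
by rewrite !(mulmx0, mul0mx, mulmx1, mul1mx, addr0, add0r) eC2.
Qed.

End Valuation.

(** * Residues of metabolic forms *)

Section Residue.
Variables (K k : fieldType) (v : K -> int) (pi : K) (red : K -> k).
Hypothesis Hv : discrete_valuation v pi.
Hypothesis Hr : residue_map v red.
Local Notation R := (in_R v).
Local Notation integral := (integral_mx v).
Local Notation Red := (map_mx red).

(** The cofactors along column [i] do not see [w], so they are those of the identity. The formula
    turns an entry of a matrix whose chosen columns form the identity into a maximal minor. *)
Lemma det_replace_col n (w : 'cV[K]_n) i :
  \det (\matrix_(a, b) (if b == i then w a 0 else (a == b)%:R)) = w i 0.
Proof.
set M := \matrix_(a, b) _.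
rewrite (expand_det_col M i).
transitivity (((\adj 1%:M : 'M[K]_n) *m w) i 0).
  rewrite mxE; apply: eq_bigr => a _; rewrite !mxE eqxx mulrC; congr (_ * _).
  rewrite /cofactor; congr (_ * \det _); apply/matrixP => x y; rewrite !mxE.
  by rewrite eq_sym (negPf (neq_lift _ _)).
by rewrite -[\adj _]mul1mx mul_mx_adj det1 mul1mx.
Qed.

(* Normalizing by a maximal minor of least valuation: by Cramer's rule all the
   entries are then quotients of minors, hence integral. *)
Lemma integral_echelon m N (U : 'M[K]_(m, N)) : row_free U ->
  exists A : 'M[K]_m, [/\ A \in unitmx, integral (A *m U) & row_free (Red (A *m U))].
Proof.
move=> fU.
have fUT : row_full U^T by rewrite /row_full mxrank_tr; apply: fU.
have det0 : \det (colsub (fullrankfun fUT) U) != 0.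
  by rewrite -unitfE -[_ \is a _]/(_ \in unitmx) -unitmx_tr trmx_mxsub fullrowsub_unit.
case: (@arg_minP _ _ _ (fullrankfun fUT) (fun f : {ffun 'I_m -> 'I_N} => \det (colsub f U) != 0)
  (fun f => v (\det (colsub f U)))) => //.
move=> f df minf; set A := invmx (colsub f U).
have uf : colsub f U \in unitmx by rewrite unitmxE unitfE.
have subA : colsub f (A *m U) = 1%:M by rewrite -mulmx_colsub mulVmx.
have RAU : integral (A *m U).
  move=> i l; pose g := [ffun x => if x == i then l else f x].
  have <- : \det (colsub g (A *m U)) = (A *m U) i l.
    have := det_replace_col (col l (A *m U)) i; rewrite [RHS]mxE => <-.
    congr (\det _); apply/matrixP => a b.
    rewrite [RHS]mxE [LHS]mxE ffunE; case: ifP => // _; first by rewrite [RHS]mxE.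
    by have /matrixP/(_ a b) := subA; rewrite mxE => ->; rewrite mxE.
  rewrite -mulmx_colsub det_mulmx det_inv.
  have [->|dg] := eqVneq (\det (colsub g U)) 0; first by rewrite mulr0 inR0.
  rewrite inRE ?mulf_neq0 ?invr_eq0 // (vM Hv) ?invr_eq0 // (vV Hv) // addrC subr_ge0.
  exact: minf.
exists A; split=> //; first by rewrite unitmx_inv.
apply/row_freeP; exists (colsub f 1%:M); rewrite mulmx_colsub mulmx1.
by rewrite -map_mxsub subA (red_mx1 Hv Hr).
Qed.

Lemma red_form m n p (A : 'M[K]_(m, n)) (B : 'M_(p, n)) (c : 'rV_n) :
  integral A -> integral B -> (forall i, R (c 0 i)) ->
  Red (A *m diag_mx c *m B^T) = Red A *m diag_mx (map_mx red c) *m (Red B)^T.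
Proof.
move=> RA RB Rc.
have Rd : integral (diag_mx c).
  by move=> i j; rewrite mxE; case: eqP => _; rewrite ?mulr0n ?inR0 // mulr1n.
have -> : diag_mx (map_mx red c) = Red (diag_mx c).
  apply/matrixP => i j; rewrite !mxE; case: eqP => _; last by rewrite (red0 Hr).
  by rewrite !mulr1n.
have RBT := integral_tr RB; have RAd := integralM Hv RA Rd.
by rewrite !(red_mulmx Hv Hr) // map_trmx.
Qed.

Lemma red_lift m n (A : 'M[k]_(m, n)) : exists2 B : 'M[K]_(m, n), integral B & Red B = A.
Proof.
have lift c : exists x, R x && (red x == c).
  by have [_ _ _ /(_ c)[x Rx <-] _] := Hr; exists x; rewrite Rx eqxx.
exists (map_mx (fun c => xchoose (lift c)) A) => [i j|].
  by rewrite mxE; case/andP: (xchooseP (lift (A i j))).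
by apply/matrixP => i j; rewrite !mxE; case/andP: (xchooseP (lift (A i j))) => _ /eqP.
Qed.

(** The unit parts mod pi at all indices, whatever the parity of the valuation: up to order, the
    diagonal of d1 + d2. *)
Definition residues N (c : 'rV[K]_N) : 'rV[k]_N :=
  \row_i red (unit_part v pi (c 0 i)).

Lemma isotropicM (F : fieldType) p m N (A : 'M[F]_(p, m)) (W : 'M_(m, N)) C :
  W *m C *m W^T = 0 -> (A *m W) *m C *m (A *m W)^T = 0.
Proof.
move=> W0; have -> : (A *m W) *m C *m (A *m W)^T = A *m (W *m C *m W^T) *m A^T.
  by rewrite trmx_mul !mulmxA.
by rewrite W0 mulmx0 mul0mx.
Qed.

(** The quotient is ceil(e / 2). The constant -1 is a factor pi^-1 taken out of the whole form,
    after which odd exponents leave units and even ones leave unit multiples of pi. *)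
Lemma double_half_odd (e : int) :
  e = -1 + ((e + odd (absz e)) %/ 2)%Z + ((e + odd (absz e)) %/ 2)%Z
        + (~~ odd (absz e) : nat)%:Z.
Proof. lia. Qed.

Lemma isotropic_scale m N (U : 'M[K]_(m, N)) (c s d : 'rV[K]_N) (x : K) :
  x != 0 -> (forall i, c 0 i = x * s 0 i ^+ 2 * d 0 i) ->
  U *m diag_mx c *m U^T = 0 ->
  (U *m diag_mx s) *m diag_mx d *m (U *m diag_mx s)^T = 0.
Proof.
move=> x0 e iU; apply: (scalerI x0); rewrite scaler0 -iU.
have -> : diag_mx c = x *: (diag_mx s *m diag_mx d *m diag_mx s).
  rewrite !mulmx_diag -linearZ /=; congr diag_mx.
  by apply/rowP => i; rewrite !mxE e; ring.
by rewrite trmx_mul tr_diag_mx -scalemxAr -scalemxAl !mulmxA.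
Qed.

(** A lagrangian normalized by [integral_echelon] keeps its rank mod pi. Its projection [ZJ] to the
    odd coordinates is isotropic, and the kernel of that projection gives a subspace [T] of the even
    coordinates, isotropic as well. The ranks of [ZJ] and [T] add up to [m], so their sum is a
    lagrangian of the residue form. *)
Lemma metabolic_residue m N (c : 'rV[K]_N) (U : 'M[K]_(m, N)) :
  (forall i, c 0 i != 0) -> row_free U -> (m.*2 = N)%N ->
  U *m diag_mx c *m U^T = 0 ->
  exists2 V : 'M[k]_N, ((\rank V).*2 = N)%N &
    V *m diag_mx (residues c) *m V^T = 0.
Proof.
move=> c0 fU em iU.
pose u i := unit_part v pi (c 0 i).
pose o i := odd (absz (v (c 0 i))).
pose s : 'rV[K]_N := \row_i pi ^ ((v (c 0%R i) + o i) %/ 2)%Z.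
pose c1 : 'rV[K]_N := \row_i (u i * pi ^ (~~ o i : nat)%:Z).
have p0 := pi_neq0 Hv.
have iU1 : (U *m diag_mx s) *m diag_mx c1 *m (U *m diag_mx s)^T = 0.
  apply: isotropic_scale iU; first exact: invr_neq0 p0.
  move=> i; rewrite !mxE {1}(unit_partE Hv (c 0 i)) -/(u i).
  rewrite {1}(double_half_odd (v (c 0 i))) !(expfzDr _ _ p0) expr2 -/(o i).
  by rewrite (exprN1 pi); case: (o i); rewrite ?expr0z ?expr1z; field.
have us : diag_mx s \in unitmx.
  rewrite unitmxE det_diag unitfE; apply/prodf_neq0 => i _.
  by rewrite mxE (piX_neq0 Hv).
have [A [uA RZ fZ]] := @integral_echelon _ _ (U *m diag_mx s)
  (row_free_mul fU (etrans (row_free_unit _) us)).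
set Z := A *m (U *m diag_mx s) in RZ fZ.
have iZ : Z *m diag_mx c1 *m Z^T = 0 by exact: isotropicM.
have Ru i : R (u i) by exact: inR_unit_part.
clearbody Z.
pose J : 'rV[k]_N := \row_i (o i)%:R.
pose J' : 'rV[k]_N := \row_i (~~ o i)%:R.
set D := residues c.
set ZJ := Red Z *m diag_mx J.
have diagJ : diag_mx J + diag_mx J' = 1%:M.
  apply/matrixP => i j; rewrite !mxE; case: eqP => [->|_]; last by rewrite addr0.
  by case: (o j); rewrite /= ?addr0 ?add0r.
have red_c1 : diag_mx (map_mx red c1) = diag_mx J *m diag_mx D *m (diag_mx J)^T.
  rewrite tr_diag_mx !mulmx_diag; congr diag_mx; apply/rowP => i; rewrite !mxE -/(u i).
  case: (o i); rewrite /= ?mul1r ?mulr1 ?mul0r //.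
  by rewrite mulrC (red_piM Hv Hr).
have isoZJ : ZJ *m diag_mx D *m ZJ^T = 0.
  have := red_form RZ RZ (c := c1); rewrite iZ red_c1 => e.
  rewrite /ZJ trmx_mul !mulmxA in e *; rewrite -e.
    by apply/matrixP => i j; rewrite !mxE (red0 Hr).
  move=> i; rewrite mxE; apply: (inRM Hv) => //.
  by rewrite inRE ?(piX_neq0 Hv) // (v_piX Hv).
(* Lifted to R, the kernel consists of vectors whose odd coordinates are divisible by pi. Dividing
   these by pi, and the form by pi, gives the form [c2], in which the even coordinates carry the
   units. *)
have [P RP eP] := red_lift (kermx ZJ).
pose T := kermx ZJ *m Red Z.
have TJ : T *m diag_mx J = 0 by rewrite -mulmxA mulmx_ker.
pose s2 : 'rV[K]_N := \row_i pi ^ (- (o i : nat)%:Z).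
pose c2 : 'rV[K]_N := \row_i (u i * pi ^ (o i : nat)%:Z).
have redPZ : Red (P *m Z) = T by rewrite (red_mulmx Hv Hr) // eP.
have RPZ : integral (P *m Z) by exact: (integralM Hv).
have RT1 : integral (P *m Z *m diag_mx s2).
  move=> a i; rewrite mul_mx_diag mxE [s2 _ _]mxE.
  case oi: (o i); last by rewrite oppr0 expr0z mulr1.
  have : red ((P *m Z) a i) == 0.
    have /matrixP/(_ a i) := TJ.
    by rewrite -redPZ mul_mx_diag mxE [J _ _]mxE oi mulr1 mxE [in X in _ = X]mxE => ->.
  rewrite (red_eq0 Hr) //; have [->|x0] := eqVneq ((P *m Z) a i) 0.
    by rewrite mul0r inR0.
  move=> /= vx; rewrite inRE ?mulf_neq0 ?(piX_neq0 Hv) //.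
  by rewrite (vM Hv) ?(piX_neq0 Hv) // (v_piX Hv) subr_ge0.
have iT1 : (P *m Z *m diag_mx s2) *m diag_mx c2 *m (P *m Z *m diag_mx s2)^T = 0.
  apply: (isotropic_scale p0) (_ : _ *m diag_mx c1 *m _ = 0).
    move=> i; rewrite !mxE expr2.
    by case: (o i); rewrite ?oppr0 ?expr0z ?exprN1 ?expr1z; field.
  exact: isotropicM.
have red_c2 : diag_mx (map_mx red c2) = diag_mx J' *m diag_mx D *m (diag_mx J')^T.
  rewrite tr_diag_mx !mulmx_diag; congr diag_mx; apply/rowP => i; rewrite !mxE -/(u i).
  case: (o i); rewrite /= ?mul1r ?mulr1 ?mul0r //.
  by rewrite mulrC (red_piM Hv Hr).
have T1J' : Red (P *m Z *m diag_mx s2) *m diag_mx J' = T.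
  rewrite -[RHS]mulmx1 -diagJ mulmxDr TJ add0r -redPZ.
  apply/matrixP => a i; rewrite !mul_mx_diag [LHS]mxE [RHS]mxE ![J' _ _]mxE.
  case oi: (o i); first by rewrite !mulr0.
  by rewrite !mulr1 ![Red _ _ _]mxE [X in red X]mxE [s2 _ _]mxE oi oppr0 expr0z mulr1.
have isoT : T *m diag_mx D *m T^T = 0.
  have := red_form RT1 RT1 (c := c2); rewrite iT1 red_c2 => e.
  rewrite -T1J' trmx_mul !mulmxA in e *; rewrite -e.
    by apply/matrixP => i j; rewrite !mxE (red0 Hr).
  move=> i; rewrite mxE; apply: (inRM Hv) => //.
  by rewrite inRE ?(piX_neq0 Hv) // (v_piX Hv).
have cross : T *m diag_mx D *m ZJ^T = 0.
  rewrite /ZJ trmx_mul tr_diag_mx mulmxA -(mulmxA T) diag_mx_comm mulmxA.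
  by rewrite TJ !mul0mx.
have cross' : ZJ *m diag_mx D *m T^T = 0.
  by apply: trmx_inj; rewrite trmx_mul trmxK (trmx_mul ZJ) tr_diag_mx mulmxA cross trmx0.
have rT : \rank T = (m - \rank ZJ)%N by rewrite mxrankMfree // mxrank_ker.
have cap0 : (ZJ :&: T)%MS = 0.
  apply/eqP/rowV0P => x; rewrite sub_capmx => /andP[/submxP[y ey] /submxP[z ez]].
  have xJ : x *m diag_mx J = x.
    rewrite ey /ZJ -!mulmxA mulmx_diag; congr (_ *m (_ *m diag_mx _)).
    by apply/rowP => i; rewrite !mxE; case: (o i); rewrite ?mulr1 ?mulr0.
  by rewrite -xJ ez -mulmxA TJ mulmx0.
clearbody T ZJ; exists (ZJ + T)%MS.
  by rewrite mxrank_disjoint_sum // rT subnKC // rank_leq_row.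
have /sub_addsmxP[[x y] /= ->] := submx_refl (ZJ + T)%MS.
rewrite raddfD /= !trmx_mul !mulmxDl !mulmxDr -!(mulmxA x) -!(mulmxA y) !mulmxA.
rewrite -!(mulmxA x) -!(mulmxA y) isoZJ isoT cross cross'.
by rewrite !mul0mx !mulmx0 !addr0.
Qed.
End Residue.

(** * Reduction of an invariant form *)

Section Reduction.
Variables (K k : fieldType) (v : K -> int) (pi : K) (red : K -> k).
Hypothesis Hv : discrete_valuation v pi.
Hypothesis Hr : residue_map v red.
Local Notation R := (in_R v).
Local Notation integral := (integral_mx v).
Local Notation Red := (map_mx red).
Local Notation res := (residues v pi red).

Lemma residues_row_mx n (a b : 'rV[K]_n) : (forall i, b 0 i != 0) ->
  diag_mx (res (row_mx a (- b))) = block_mx (diag_mx (res a)) 0 0 (- diag_mx (res b)).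
Proof.
move=> b0; rewrite -raddfN /= -diag_mx_row; congr diag_mx; apply/rowP => i.
rewrite mxE -[i]splitK; case: (split i) => j /=.
  by rewrite !row_mxEl mxE.
rewrite !row_mxEr !mxE /unit_part (vN Hv) // mulNr (redN Hv Hr) //.
exact: inR_unit_part.
Qed.

(** The graph of [X] is a lagrangian of diag(b) _|_ (-diag(a)), to which [metabolic_residue]
    applies. This is the independence of d1 + d2 from the diagonalization. *)
Lemma residues_witt n (a b : 'rV[K]_n) (X : 'M_n) :
  (forall i, a 0 i != 0) -> (forall i, b 0 i != 0) ->
  X *m diag_mx a *m X^T = diag_mx b ->
  witt (diag_mx (res b)) (diag_mx (res a)).
Proof.
move=> a0 b0 e.
have [i||||V rV iV] := @metabolic_residue K k v pi red Hv Hr n (n + n) (row_mx b (- a)) (row_mx 1%:M X).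
- rewrite -[i]splitK; case: (split i) => j /=; first by rewrite row_mxEl.
  by rewrite row_mxEr mxE oppr_eq0.
- by apply: row_free_row_mxl; rewrite row_free_unit unitmx1.
- by rewrite addnn.
- by rewrite diag_mx_row raddfN mul_row_diag_block mul1mx trmx1 mulmx1 e subrr.
apply/witt_wittE; exists V => //.
by rewrite -residues_row_mx.
Qed.

(** Listing the even positions before the odd ones is a permutation of the coordinates, so the
    congruence is by a permutation matrix. *)
Lemma springer_witt n (a : 'rV[K]_n) :
  witt (diag_mx (res a)) (diag_seq (springer1 v pi red a ++ springer2 v pi red a)).
Proof.
rewrite /springer1 /springer2 -map_cat.
set e := _ ++ _.
have pe : perm_eq e (enum 'I_n).
  have oE : predC (fun i => ~~ odd (absz (v (a 0 i)))) =1 (fun i => odd (absz (v (a 0 i)))).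
    by move=> i; apply: negbK.
  by have /permPl := perm_filterC (fun i => ~~ odd (absz (v (a 0 i)))) (enum 'I_n); rewrite (eq_filter oE).
have ue : uniq e by rewrite (perm_uniq pe) enum_uniq.
have se : size e = n by rewrite (perm_size pe) size_enum_ord.
set s := map _ e.
have ss : size s = n by rewrite size_map.
pose X : 'M[k]_(size s, n) := \matrix_(i, j) (nth j e i == j)%:R.
apply: (witt_congr (X := X)); first by [].
apply/matrixP => i j; rewrite !mxE.
have lt (i0 : 'I_(size s)) : (i0 < size e)%N by rewrite se -ss.
(* A default for [nth], never returned since every index is below the length of [e]. *)
have i1 : 'I_n by rewrite -ss.
rewrite (bigD1 (nth i1 e i)) //= big1 => [|l ne]; last first.
  rewrite mul_mx_diag !mxE (set_nth_default i1) // eq_sym (negPf ne).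
  by rewrite !mul0r.
rewrite addr0 mul_mx_diag !mxE !(set_nth_default i1 (nth i1 e i)) //.
rewrite eqxx mul1r nth_uniq // eq_sym -[(i == j :> nat)]/(i == j).
case: eqP => [->|_]; rewrite ?mulr0 ?mulr0n // mulr1 mulr1n.
by rewrite (nth_map i1).
Qed.

(** Conjugation by diag(s) together with a global factor [x] on the form; the factor lets the form
    on the companion lattice be multiplied by pi. *)
Lemma isometry_rescale n (M M' : 'M[K]_n) (d d' s : 'rV_n) x :
  (forall i, s 0 i != 0) ->
  (forall i j, M' i j = (s 0 i)^-1 * s 0 j * M i j) ->
  (forall i, d' 0 i = x * (d 0 i / s 0 i ^+ 2)) ->
  M *m diag_mx d *m M^T = diag_mx d -> M' *m diag_mx d' *m M'^T = diag_mx d'.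
Proof.
move=> s0 eM ed /matrixP iM; apply/matrixP => i j.
transitivity (x / (s 0 i * s 0 j) * (M *m diag_mx d *m M^T) i j).
  rewrite !mul_mx_diag !mxE mulr_sumr; apply: eq_bigr => l _.
  by rewrite !mxE !eM ed; field; rewrite !s0.
rewrite iM !mxE; case: eqP => [->|_]; rewrite ?mulr0n ?mulr0 // !mulr1n ed.
by rewrite expr2; field; rewrite s0.
Qed.

Lemma half_odd (z : int) : z = (z %/ 2)%Z + (z %/ 2)%Z + (odd (absz z) : nat)%:Z.
Proof. lia. Qed.

(** Writing e_i = 2 f_i + o_i, [M2] is the action on L1 with basis pi^(-f_i) e_i. Its reduction need
    not preserve the residue form, but its graded module for the parity [o] does. *)
Lemma reduction_form (G : Type) n (M : G -> 'M[K]_n) (d : 'rV[K]_n) :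
  (forall i, d 0 i != 0) -> (forall g, integral (M g)) ->
  (forall g, exists2 M', integral M' & M g *m M' = 1%:M) ->
  (forall g, M g *m diag_mx d *m (M g)^T = diag_mx d) ->
  exists N : G -> 'M[k]_n,
    ssz_eq (Rep (fun g => Red (M g))) (Rep N) /\
    inv_form (t := Rep N) (diag_mx (res d)).
Proof.
move=> d0 RM invM isoM.
pose u i := unit_part v pi (d 0 i).
pose e i : int := v (d 0 i).
pose f i : int := (e i %/ 2)%Z.
pose o i : nat := odd (absz (e i)).
have ef i : e i = f i + f i + (o i)%:Z by exact: half_odd.
have ole i : (o i <= 1)%N by rewrite /o; case: odd.
have eE i : e i = v (d 0 i) by [].
clearbody o f e.
have p0 := pi_neq0 Hv.
(* The second bound comes from the inverse [M']: invariance reads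
   [diag_mx d *m (M g)^T = M' *m diag_mx d], and [M'] is integral. *)
have vM1 g i j : M g i j != 0 -> (0 <= v (M g i j)) /\ (e i - e j <= v (M g i j)).
  move=> x0; split; first by have := RM g i j; rewrite inRE.
  have [M' RM' MM'] := invM g.
  have ud : diag_mx d \in unitmx.
    by rewrite unitmxE det_diag unitfE; apply/prodf_neq0 => l _.
  have eM' : diag_mx d *m (M g)^T = M' *m diag_mx d.
    rewrite -[LHS]mul1mx -(mulmx1C MM') -!mulmxA; congr (_ *m _).
    by rewrite mulmxA isoM.
  have := RM' j i; have /matrixP/(_ j i) := eM'.
  rewrite mul_diag_mx mul_mx_diag !mxE => eji.
  have M'0 : M' j i != 0.
    apply/eqP => z; move/eqP: eji; rewrite z mul0r mulf_eq0 (negPf x0) orbF.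
    by rewrite (negPf (d0 j)).
  have := congr1 v eji; rewrite !(vM Hv) // -!eE => ve.
  rewrite inRE //; move: ve; clear.
  by move: (v (M g i j)) (v (M' j i)) (e i) (e j) => x y z t; lia.
pose M2 g : 'M[K]_n := \matrix_(i, j) (pi ^ (f j - f i) * M g i j).
(* The action on the companion lattice with basis pi^(-ceil(e_i / 2)) e_i; it agrees with [M2]
   within a parity block. *)
pose M4 g : 'M[K]_n := \matrix_(i, j) (pi ^ ((o j)%:Z - (o i)%:Z) * M2 g i j).
have M20 g i j : (M2 g i j == 0) = (M g i j == 0).
  by rewrite mxE mulf_eq0 (negPf (piX_neq0 Hv _)).
have M40 g i j : (M4 g i j == 0) = (M g i j == 0).
  by rewrite mxE mulf_eq0 (negPf (piX_neq0 Hv _)) M20.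
have vM2 g i j : M g i j != 0 -> v (M2 g i j) = f j - f i + v (M g i j).
  by move=> x0; rewrite mxE (vM Hv) ?(piX_neq0 Hv) // (v_piX Hv).
have vM4 g i j : M g i j != 0 ->
    v (M4 g i j) = (o j)%:Z - (o i)%:Z + (f j - f i + v (M g i j)).
  by move=> x0; rewrite mxE (vM Hv) ?(piX_neq0 Hv) ?M20 // (v_piX Hv) vM2.
have RM2 g : integral (M2 g).
  move=> i j; have [z|x0] := eqVneq (M g i j) 0.
    by rewrite /in_R M20 z eqxx.
  rewrite inRE ?M20 // vM2 //; have [] := vM1 g i j x0.
  move: (ef i) (ef j) (ole i) (ole j); clear; lia.
have RM4 g : integral (M4 g).
  move=> i j; have [z|x0] := eqVneq (M g i j) 0.
    by rewrite /in_R M40 z eqxx.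
  rewrite inRE ?M40 // vM4 //; have [] := vM1 g i j x0.
  move: (ef i) (ef j) (ole i) (ole j); clear; lia.
have redz x : R x -> (x != 0 -> 1 <= v x) -> red x = 0.
  move=> Rx h; apply/eqP; rewrite (red_eq0 Hr) //.
  by have [//|x0] := eqVneq x 0; apply: h.
(* A shift that makes the levels f_i + m natural numbers. *)
pose m : int := \sum_i `|f i|.
have fm i : 0 <= f i + m.
  have : `|f i| <= m by rewrite /m (bigD1 i) //= lerDl sumr_ge0.
  by move: (f i) m; clear; lia.
pose h i : nat := absz (f i + m).
have hE i : (h i)%:Z = f i + m by rewrite /h gez0_abs.
have rM g i j : (h j < h i)%N -> Red (M g) i j = 0.
  move=> hij; rewrite mxE; apply: redz (RM g i j) _ => x0; have [] := vM1 g i j x0.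
  move: hij (hE i) (hE j) (ef i) (ef j) (ole i) (ole j); clear; lia.
have rM2 g i j : (h i < h j)%N -> Red (M2 g) i j = 0.
  move=> hij; rewrite mxE; apply: redz (RM2 g i j) _ => x0; rewrite M20 in x0.
  rewrite vM2 //; have [] := vM1 g i j x0.
  move: hij (hE i) (hE j) (ef i) (ef j) (ole i) (ole j); clear; lia.
have rM2o g i j : (o j < o i)%N -> Red (M2 g) i j = 0.
  move=> oij; rewrite mxE; apply: redz (RM2 g i j) _ => x0; rewrite M20 in x0.
  rewrite vM2 //; have [] := vM1 g i j x0.
  move: oij (ef i) (ef j) (ole i) (ole j); clear; lia.
(* For equal levels [h] the scaling factor is 1, so [M] and [M2] have the same [h]-graded
   reduction. *)
exists (graded o (fun g => Red (M2 g))); split.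
  apply: ssz_eq_trans (filtered_ssz_eq_rev (h := h) rM) _.
  apply: ssz_eq_trans (filtered_ssz_eq_rev (h := o) rM2o).
  apply: ssz_eq_trans (ssz_eq_sym (filtered_ssz_eq (h := h) rM2)).
  apply/iso_ssz_eq/rep_eq_iso => g; apply/matrixP => i j; rewrite !mxE.
  case: eqP => // hij; have -> : f j - f i = 0; last by rewrite expr0z mul1r.
  by move: hij (hE i) (hE j); clear; lia.
split; first split.
- by rewrite tr_diag_mx.
- rewrite unitmxE det_diag unitfE; apply/prodf_neq0 => l _.
  by rewrite mxE (red_unit_part Hv Hr).
(* Mod pi, [d2] survives exactly where [o] is 0 and [d4] exactly where [o] is 1, so each yields
   invariance on one of the two diagonal blocks. *)
pose d2 : 'rV[K]_n := \row_i (u i * pi ^ (o i)%:Z).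
pose d4 : 'rV[K]_n := \row_i (u i * pi ^ (1 - (o i)%:Z)).
have Ru i : R (u i) by exact: inR_unit_part.
have Rd2 i : R (d2 0 i).
  by rewrite mxE (inRM Hv) // inRE ?(piX_neq0 Hv) // (v_piX Hv).
have Rd4 i : R (d4 0 i).
  rewrite mxE (inRM Hv) // inRE ?(piX_neq0 Hv) // (v_piX Hv).
  by move: (ole i); clear; lia.
have eu i : d 0 i = u i * (pi ^ f i * pi ^ f i * pi ^ (o i)%:Z).
  by rewrite {1}(unit_partE Hv (d 0 i)) -eE -!expfzDr // -ef.
have iso2 g : M2 g *m diag_mx d2 *m (M2 g)^T = diag_mx d2.
  apply: (isometry_rescale (s := \row_i pi ^ f i) (x := 1)) (isoM g) => [i|i j|i].
  - by rewrite mxE (piX_neq0 Hv).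
  - by rewrite !mxE expfzDr // -invr_expz; congr (_ * _); rewrite mulrC.
  - by rewrite !mxE eu; field; rewrite (piX_neq0 Hv).
have iso4 g : M4 g *m diag_mx d4 *m (M4 g)^T = diag_mx d4.
  apply: (isometry_rescale (s := \row_i pi ^ (f i + (o i)%:Z)) (x := pi)) (isoM g) => [i|i j|i].
  - by rewrite mxE (piX_neq0 Hv).
  - rewrite !mxE mulrA -expfzDr // invr_expz -expfzDr //; congr (pi ^ _ * _).
    by clear; lia.
  - rewrite !mxE eu !expfzDr // expr1z -invr_expz; field.
    by rewrite !(piX_neq0 Hv).
have red_d2 i : red (d2 0 i) = if o i == 0%N then red (u i) else 0.
  rewrite mxE; case: (o i) (ole i) => [|[|//]] _; first by rewrite /= expr0z mulr1.
  by rewrite /= expr1z mulrC (red_piM Hv Hr).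
have red_d4 i : red (d4 0 i) = if o i == 0%N then 0 else red (u i).
  rewrite mxE; case: (o i) (ole i) => [|[|//]] _; last by rewrite /= subrr expr0z mulr1.
  by rewrite /= subr0 expr1z mulrC (red_piM Hv Hr).
move=> g /=.
have e2 := red_form Hv Hr (RM2 g) (RM2 g) Rd2; rewrite iso2 in e2.
have e4 := red_form Hv Hr (RM4 g) (RM4 g) Rd4; rewrite iso4 in e4.
apply/matrixP => i j; rewrite mul_mx_diag [LHS]mxE.
have [oij|oij] := eqVneq (o i) (o j); last first.
  rewrite big1 => [|l _].
    by rewrite mxE; case: (i =P j) oij => [->|_ _]; rewrite ?eqxx // mulr0n.
  rewrite !mxE; case: eqP => [oil|]; last by rewrite !mul0r.
  by rewrite -oil eq_sym (negPf oij) mulr0.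
have [oi|oi] := eqVneq (o i) 0%N.
  have /matrixP/(_ i j) := e2; rewrite mul_mx_diag mxE [X in red X]mxE [RHS]mxE => e2'.
  transitivity (red (d2 0 i *+ (i == j))); last first.
    rewrite [RHS]mxE [res d 0 i]mxE; case: eqP => _; last by rewrite !mulr0n (red0 Hr).
    by rewrite !mulr1n red_d2 oi eqxx.
  rewrite e2'; apply: eq_bigr => l _; rewrite !mxE -oij oi.
  have := red_d2 l; rewrite mxE => ->.
  by rewrite eq_sym; case: eqP; rewrite ?mul0r ?mulr0 ?mul0r.
have /matrixP/(_ i j) := e4; rewrite mul_mx_diag mxE [X in red X]mxE [RHS]mxE => e4'.
transitivity (red (d4 0 i *+ (i == j))); last first.
  rewrite [RHS]mxE [res d 0 i]mxE; case: eqP => _; last by rewrite !mulr0n (red0 Hr).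
  by rewrite !mulr1n red_d4 (negPf oi).
rewrite e4'; apply: eq_bigr => l _; rewrite !mxE -oij.
have := red_d4 l; rewrite mxE => ->.
case: eqP => [oil|oil].
  by rewrite -oil (negPf oi) subrr expr0z !mul1r.
have -> : o l = 0%N by move: oil oi (ole i) (ole l); clear; lia.
by rewrite /= !mulr0 !mul0r.
Qed.

End Reduction.

(** * Arbitrary diagonalizations and composition series: the theorem *)

Lemma unitmx_diag_mx (F : fieldType) n (d : 'rV[F]_n) :
  (diag_mx d \in unitmx) = [forall i, d 0 i != 0].
Proof.
rewrite unitmxE det_diag unitfE; apply/prodf_neq0/forallP => [h i|h i _]; exact: h.
Qed.

Lemma unitmx_diag_seq (F : fieldType) (s : seq F) :
  (forall x, x \in s -> x != 0) -> diag_seq s \in unitmx.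
Proof.
move=> s0; rewrite unitmx_diag_mx; apply/forallP => i; rewrite mxE.
by apply: s0; apply: mem_nth.
Qed.

(** The matrix of the neutral element is idempotent and invertible, hence the identity. *)
Lemma rep_inv (F : fieldType) n (G : Type) mulG (oneG : G) invG
    (rho : G -> 'M[F]_n) g :
  group_law mulG oneG invG -> is_rep mulG rho -> rho g *m rho (invG g) = 1%:M.
Proof.
move=> [_ left1 leftV] [urho rhoM]; apply: mulmx1C.
rewrite -rhoM leftV -[LHS]mul1mx -{1}(mulVmx (urho oneG)) -mulmxA -rhoM left1.
by rewrite mulVmx.
Qed.

Theorem theoremB (K k : fieldType) (v : K -> int) (pi : K) (red : K -> k)
  (G : Type) (mulG : G -> G -> G) (oneG : G) (invG : G -> G)
  (n : nat) (rho : G -> 'M[K]_n) (S : 'M[K]_n) :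
  discrete_valuation v pi -> residue_map v red -> (2%:R : k) != 0 ->
  group_law mulG oneG invG -> is_rep mulG rho ->
  (exists B, stable_lattice v rho B) ->
  nondeg_sym S -> invariant_form rho S ->
  forall B : 'M[K]_n, stable_lattice v rho B ->
  forall (Q : 'M[k]_n) (blk : 'I_n -> nat),
    composition_data (red_rep red rho B) Q blk ->
  forall (P : 'M[K]_n) (a : 'rV[K]_n),
    P \in unitmx -> P *m S *m P^T = diag_mx a ->
  exists T : 'M[k]_n,
    [/\ nondeg_sym T,
        invariant_form (graded_rep (red_rep red rho B) Q blk) T &
        witt_eq T (diag_seq (springer1 v pi red a ++ springer2 v pi red a))].
Proof.
move=> Hv Hr two law reprho _ [sS uS] iS B [uB RB] Q blk comp P a uP ePa.
have sSB : (B *m S *m B^T)^T = B *m S *m B^T by rewrite !trmx_mul trmxK sS mulmxA.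
have [C [C' [d [[RC RC' CC'] ed]]]] := unimodular_diag Hv Hr two sSB.
have C'C := mulmx1C CC'.
have uC : C \in unitmx by case: (mulmx1_unit CC').
have d0 i : d 0 i != 0.
  suff : diag_mx d \in unitmx by rewrite unitmx_diag_mx => /forallP.
  by rewrite -ed !unitmx_mul !unitmx_tr uC uB uS.
have a0 i : a 0 i != 0.
  suff : diag_mx a \in unitmx by rewrite unitmx_diag_mx => /forallP.
  by rewrite -ePa !unitmx_mul !unitmx_tr uP uS.
(* The action on L in the R-basis given by the rows of [C *m B], where q is diagonal. *)
pose M g := C *m (B *m rho g *m invmx B) *m C'.
have RM g : integral_mx v (M g).
  by apply: (integralM Hv) RC'; apply: (integralM Hv) (RB g).
have invM g : exists2 M', integral_mx v M' & M g *m M' = 1%:M.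
  exists (M (invG g)) => //.
  rewrite /M !mulmxA -(mulmxA _ C' C) C'C mulmx1 mulmxKV //.
  by rewrite -(mulmxA (C *m B)) (rep_inv g law reprho) mulmx1 mulmxK.
have isoM g : M g *m diag_mx d *m (M g)^T = diag_mx d.
  have MCB : M g *m (C *m B) = C *m B *m rho g.
    by rewrite /M !mulmxA -(mulmxA _ C' C) C'C mulmx1 mulmxKV.
  have eCB : diag_mx d = (C *m B) *m S *m (C *m B)^T.
    by rewrite -ed trmx_mul !mulmxA.
  transitivity ((M g *m (C *m B)) *m S *m (M g *m (C *m B))^T).
    by rewrite eCB (trmx_mul (M g)) !mulmxA.
  transitivity (C *m B *m (rho g *m S *m (rho g)^T) *m (C *m B)^T); last by rewrite iS.
  by rewrite MCB (trmx_mul (C *m B)) !mulmxA.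
have [N [eqN fN]] := reduction_form Hv Hr d0 RM invM isoM.
have sszN : ssz (Rep N) (Rep (graded_rep (red_rep red rho B) Q blk)).
  apply/eqN; apply: ssz_isol (composition_ssz comp).
  have CC'k : map_mx red C' *m map_mx red C = 1%:M.
    by rewrite -(red_mulmx Hv Hr) // C'C (red_mx1 Hv Hr).
  have [uC'k _] := mulmx1_unit CC'k.
  exists (map_mx red C'); rewrite row_free_unit row_full_unit uC'k; split=> // g.
  rewrite /= /M (red_mulmx Hv Hr (integralM Hv RC (RB g)) RC') (red_mulmx Hv Hr RC (RB g)).
  by rewrite !mulmxA CC'k mul1mx.
have [T [nT iT] wT] := semisimple_form (leqnn _) sszN fN.
exists T; split=> //; apply/witt_wittE.
have uda : diag_mx (residues v pi red a) \in unitmx.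
  rewrite unitmx_diag_mx; apply/forallP => i; rewrite mxE.
  exact: (red_unit_part Hv Hr).
have us : diag_seq (springer1 v pi red a ++ springer2 v pi red a) \in unitmx.
  apply: unitmx_diag_seq => x; rewrite mem_cat.
  by case/orP => /mapP[i _ ->]; exact: (red_unit_part Hv Hr).
have [[_ ud] _] := fN; have [_ uT] := nT.
apply: (witt_trans uT ud us wT); apply: (witt_trans ud uda us) (springer_witt _ _ _ _).
(* The matrix passes from the given diagonalization [a], by the basis [P], to the diagonalization
   [d] adapted to the lattice. *)
apply: (residues_witt Hv Hr (X := C *m B *m invmx P)) => //.
rewrite -ePa -ed !trmx_mul !mulmxA mulmxKV // -!mulmxA.
by rewrite (mulmxA P^T) -trmx_mul mulVmx // trmx1 mul1mx.
Qed.
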